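(* Let $G$ be a finite graph and let $$c=\max\left\{35216,\ 8\,\frac{\log(2\pi'(G)+3)}{\log(1.01)}+216\right\}.$$ Then for every $(\ge c)$-subdivision $H$ of $G$, we have $\pi(H)=3$.
   Context: A sequence $s_1\ldots s_{2m}$ ($m\ge 1$) is a square if $s_i=s_{i+m}$ for all $i\in\{1,\ldots,m\}$; a sequence is nonrepetitive (square-free) if none of its consecutive subsequences (factors) is a square. A coloring of the vertices (resp. of the edges) of a graph is nonrepetitive if the sequence of colors of the vertices (resp. edges) along every path of the graph is nonrepetitive. $\pi(G)$ (the nonrepetitive chromatic number) is the least number of colors in a nonrepetitive vertex coloring of $G$, and $\pi'(G)$ (the nonrepetitive chromatic index) is the least number of colors in a nonrepetitive edge coloring of $G$. A graph $G'$ is a subdivision of $G$ if it is obtained by replacing each edge $vw$ of $G$ by a path with endpoints $v,w$, the new paths being pairwise internally disjoint; it is a $(\ge d)$-subdivision if every edge is replaced by a path with at least $d$ internal (division) vertices. The base of the logarithm is irrelevant since only a ratio of logarithms appears.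
   Formalization: The graph G is assumed to have at least one edge; for an edgeless G, such as a single vertex, the only subdivision is G itself and π(G) ≤ 1, so the claim π(H)=3 fails. *)

(* Defs.v *)
From mathcomp Require Import all_boot all_order all_algebra.
From mathcomp Require Import all_classical all_reals all_analysis.
Import Order.TTheory GRing.Theory Num.Theory.

Set Implicit Arguments.
Unset Strict Implicit.
Unset Printing Implicit Defensive.

Local Open Scope nat_scope.

Section Words.
Variable T : eqType.

Definition square (s : seq T) : Prop :=
  exists m, [/\ 0 < m, size s = 2 * m
              & forall i, i < m -> onth s i = onth s (i + m)].

Definition nonrepetitive (s : seq T) : Prop :=
  forall t, infix t s -> ~ square t.

Lemma uniq_nonrepetitive (s : seq T) : uniq s -> nonrepetitive s.
Proof.
move=> us t /infixP[s1 [s2 es]] [m [m_gt0 sz_t eq_t]].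
have ut : uniq t.
  by move: us; rewrite es cat_uniq => /and3P[_ _]; rewrite cat_uniq => /and3P[].
case: t es sz_t eq_t ut => [|x t] _ sz_t eq_t ut; first by case: m m_gt0 sz_t {eq_t}.
have /= := eq_t 0 m_gt0; rewrite add0n => /esym/(onth_nth x) x_m.
have m_lt : m < size (x :: t) by rewrite sz_t mul2n -addnn -{1}[m]addn0 ltn_add2l.
have := nth_uniq x (ltn0Sn (size t) : 0 < size (x :: t)) m_lt ut.
by rewrite x_m eqxx eq_sym (gtn_eqF m_gt0).
Qed.

End Words.

Record sgraph := SGraph {
  vertex :> finType;
  adj : rel vertex;
  adj_sym : symmetric adj;
  adj_irrefl : irreflexive adj }.

Section Colorings.
Variable G : sgraph.

(* An edge is the two-element set of its endpoints. *)
Definition edges : {set {set G}} :=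
  [set [set u.1; u.2] | u : G * G & adj u.1 u.2].

(* A path is given by the list of its vertices, which are pairwise distinct. *)
Definition gpath (s : seq G) : bool := sorted (@adj G) s && uniq s.

Definition path_edges (s : seq G) : seq {set G} :=
  [seq [set u.1; u.2] | u <- zip s (behead s)].

Definition nonrep_vertex_coloring (k : nat) (f : G -> nat) : Prop :=
  (forall v, f v < k) /\
  (forall s, gpath s -> nonrepetitive (map f s)).

(* The values of [f] outside [edges] are irrelevant. *)
Definition nonrep_edge_coloring (k : nat) (f : {set G} -> nat) : Prop :=
  (forall e, e \in edges -> f e < k) /\
  (forall s, gpath s -> nonrepetitive (map f (path_edges s))).

Definition nonrep_vertex_colorable (k : nat) : bool :=
  `[< exists f, nonrep_vertex_coloring k f >].

Definition nonrep_edge_colorable (k : nat) : bool :=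
  `[< exists f, nonrep_edge_coloring k f >].

Lemma ex_nonrep_vertex_colorable : exists k, nonrep_vertex_colorable k.
Proof.
exists #|G|; apply/asboolP; exists (fun v : G => nat_of_ord (enum_rank v)); split=> [v|s].
  exact: ltn_ord.
move=> /andP[_ us]; apply: uniq_nonrepetitive; rewrite map_inj_uniq //.
by move=> u v /ord_inj/enum_rank_inj.
Qed.

Lemma mem_zip (s t : seq G) u v :
  (u, v) \in zip s t -> u \in s /\ v \in t.
Proof.
elim: s t => [|x s IHs] [|y t] //=; rewrite !inE xpair_eqE.
by case/orP=> [/andP[-> ->] //|/IHs[-> ->]]; rewrite !orbT.
Qed.

Lemma path_edges_uniq (s : seq G) : uniq s -> uniq (path_edges s).
Proof.
elim: s => [|x [|y s] IHs] // /andP[x_s us].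
rewrite -[path_edges _]/([set x; y] :: path_edges (y :: s)) cons_uniq IHs // andbT.
apply: contra x_s => /mapP[[u v] /mem_zip/= [u_s v_s] /setP/(_ x)].
rewrite !inE eqxx /= => /esym/orP[/eqP->|/eqP->]; first by rewrite -in_cons.
by rewrite v_s orbT.
Qed.

Lemma ex_nonrep_edge_colorable : exists k, nonrep_edge_colorable k.
Proof.
exists #|{set G}|; apply/asboolP; exists (fun e : {set G} => nat_of_ord (enum_rank e)); split=> [e _|s].
  exact: ltn_ord.
move=> /andP[_ us]; apply: uniq_nonrepetitive.
rewrite map_inj_uniq; first exact: path_edges_uniq.
by move=> u v /ord_inj/enum_rank_inj.
Qed.

Definition nonrep_chromatic_number : nat := ex_minn ex_nonrep_vertex_colorable.

Definition nonrep_chromatic_index : nat := ex_minn ex_nonrep_edge_colorable.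

End Colorings.

(* [b] embeds the original vertices, and [P v w] lists the division vertices
   of the edge [vw], in order from [v] to [w]; it is only meaningful when [v]
   and [w] are adjacent.  The last two fields say that the subdivided graph has
   no vertices and no edges other than those of the replacement paths and the
   original vertices. *)
Record is_subdivision (G H : sgraph) (b : G -> H) (P : G -> G -> seq H) : Prop := {
  subdiv_inj : injective b;
  subdiv_rev : forall v w, adj v w -> P w v = rev (P v w);
  subdiv_path : forall v w, adj v w -> gpath (b v :: rcons (P v w) (b w));
  subdiv_branch : forall u v w, adj v w -> b u \notin P v w;
  subdiv_disjoint : forall v w v' w', adj v w -> adj v' w' ->
    [set v; w] != [set v'; w'] -> [disjoint P v w & P v' w'];
  subdiv_vertex : forall x,
    (exists u, x = b u) \/ (exists v w, adj v w /\ x \in P v w);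
  subdiv_edge : forall x y, adj x y ->
    exists v w, adj v w /\ infix [:: x; y] (b v :: rcons (P v w) (b w)) }.

Definition subdivision_ge (R : realType) (d : R) (G H : sgraph) : Prop :=
  exists (b : G -> H) (P : G -> G -> seq H), is_subdivision b P /\
    forall v w, adj v w -> (d <= (size (P v w))%:R)%R.

(* Main.v *)
Require Import Defs.
From mathcomp Require Import all_boot all_order all_algebra.
From mathcomp Require Import all_classical all_reals all_analysis.
From mathcomp Require Import zify ring lra.
From mathcomp Require Import fintype finset.
Import Order.TTheory GRing.Theory Num.Theory.

(* The end vertices of a path of the subdivision may lie inside edges of G, so a
   square along such a path is a repetition in the edge colours of a walk of G whose
   end vertices are allowed to coincide with other vertices of the walk. An edge
   colouring that is nonrepetitive along paths only does not exclude this (colour a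
   4-cycle 1212), so we first recolour the edges of G with 12 pi'(G)^2 colours,
   nonrepetitively along all these walks. As the maximum degree is at most pi'(G),
   Rosenfeld's counting argument applies: each new edge multiplies the number of good
   partial colourings by at least 4 pi'(G)^2.

   The words along the subdivided edges come from one synchronisation principle used
   twice. If a word is a concatenation of blocks separated by a palindrome S that
   occurs nowhere else, if the first half of a block determines its label, and if no
   square avoiding S occurs in two consecutive blocks, then a square in the word
   produces a square in the sequence of labels: the square meets its centre in one
   block, of which it sees a long enough part on one side or the other.
   First take S a single letter for the vertices of G, and as blocks words carrying
   the binary code of the colour of an edge at both ends. Then substitute for each
   letter a ternary word, with 1021201 as separator; every letter has a short and a
   long image, so that every sufficiently large length is obtained. *)

Set Implicit Arguments.
Unset Strict Implicit.
Unset Printing Implicit Defensive.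

Local Open Scope nat_scope.

(** * Square-free words *)

Section SquareFree.
Context {T : eqType}.
Implicit Types s t x : seq T.

Lemma squareP t : square t <-> exists2 x, x <> [::] & t = x ++ x.
Proof.
split=> [[m [m_gt0 sz_t per_t]]|[x x_nnil ->]]; last first.
  exists (size x); split; [by case: x x_nnil | by rewrite size_cat mul2n addnn|].
  by move=> i lt_i; rewrite !onth_cat lt_i ltnNge leq_addl /= addnK.
exists (take m t).
  by move/(congr1 size); rewrite size_takel ?sz_t /=; lia.
rewrite -{1}(cat_take_drop m t); congr (_ ++ _).
have x0 : T by case: t sz_t {per_t} => [|x t] //= ; lia.
apply: (@eq_from_nth _ x0) => [|i].
  by rewrite size_drop size_takel sz_t; lia.
rewrite size_drop sz_t => lt_i.
rewrite nth_drop nth_take; last lia.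
by rewrite -!odflt_onth (per_t i) 1?addnC //; lia.
Qed.

Lemma nonrepP s :
  nonrepetitive s <-> forall x, x <> [::] -> ~~ infix (x ++ x) s.
Proof.
split=> [nr x x_nnil | nr t t_s /squareP[x x_nnil def_t]].
  by apply/negP => /nr; apply; apply/squareP; exists x.
by move: (nr x x_nnil); rewrite -def_t t_s.
Qed.

Lemma nonrep_infix s t : infix s t -> nonrepetitive t -> nonrepetitive s.
Proof. by move=> s_t nr u u_s; apply: nr; apply: infix_trans s_t. Qed.

Lemma nonrep_rev s : nonrepetitive s -> nonrepetitive (rev s).
Proof.
move=> /nonrepP nr; apply/nonrepP => x x_nnil.
rewrite -infix_revLR rev_cat; apply: nr.
by move/(congr1 size); rewrite size_rev; case: x x_nnil.
Qed.

Lemma nonrep_cons_neq (a b : T) s : nonrepetitive (a :: b :: s) -> a != b.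
Proof.
move=> /nonrepP nr; apply/eqP => eq_ab.
have /negP[] := nr [:: a] ltac:(by []).
by rewrite -eq_ab /= !eqxx prefix0s.
Qed.

Fixpoint eq_upto (m : nat) s t : bool :=
  match m, s, t with
  | 0, _, _ => true
  | m'.+1, x :: s', y :: t' => if x == y then eq_upto m' s' t' else false
  | _, _, _ => false
  end.

Lemma eq_upto_cat x s t : eq_upto (size x) (x ++ s) (x ++ t).
Proof. by elim: x => //= a x IHx; rewrite eqxx. Qed.

(** The invariant is [t = drop m s]. Each round compares [s] with its shift by [m.+1]; agreement on
    [m.+1] letters is a square of half-length [m.+1] at the head of [s]. *)
Fixpoint no_square_prefix (fuel m : nat) s t : bool :=
  match fuel, t with
  | fuel'.+1, _ :: t' =>
      if eq_upto m.+1 s t' then false else no_square_prefix fuel' m.+1 s t'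
  | _, _ => true
  end.

Lemma no_square_prefixP fuel m s t x :
  no_square_prefix fuel m s t -> s = x ++ x ++ drop (size x).*2 s ->
  t = drop m s -> m < size x <= m + fuel -> False.
Proof.
elim: fuel m t => [|fuel IHfuel] m t /=; first by lia.
case: t => [|y t] /=.
  move=> _ def_s /(congr1 size)/=; rewrite def_s size_drop !size_cat; lia.
case: ifP => // neq nsq def_s def_t /andP[m_x x_m].
have def_t' : t = drop m.+1 s by rewrite -add1n -drop_drop -def_t /= drop0.
have [eq_xm|ne_xm] := eqVneq (size x) m.+1; last first.
  by apply: IHfuel nsq def_s def_t' _; lia.
case/negP: (negbT neq).
change (eq_upto m.+1 s t); rewrite -eq_xm def_t' -eq_xm.
have -> : drop (size x) s = x ++ drop (size x).*2 s by rewrite {1}def_s drop_size_cat.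
by rewrite {1}def_s eq_upto_cat.
Qed.

Fixpoint nonrepb s : bool :=
  if s is _ :: s' then no_square_prefix (size s) 0 s s && nonrepb s' else true.

Lemma nonrepbP s : nonrepb s -> nonrepetitive s.
Proof.
move=> nrs; apply/nonrepP => x x_nnil.
elim: s nrs => [_|y s IHs]; first by case: x x_nnil.
case/andP=> nsq /IHs nrs; rewrite infix_consl.
apply/norP; split=> //; apply/negP => /prefixP[z def_s].
apply: (no_square_prefixP (x := x) nsq) => //; rewrite ?drop0 //.
  by rewrite def_s -catA; congr (_ ++ (_ ++ _)); rewrite catA drop_size_cat // size_cat addnn.
have : size (y :: s) = size x + size x + size z by rewrite def_s !size_cat.
have : 0 < size x by case: x x_nnil {IHs nrs def_s nsq}.
by rewrite /=; lia.
Qed.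

End SquareFree.

(** Levi's lemma: [e] is the piece between the two cuts of the word. *)
Lemma cat_eq_cases (T : Type) (a b c d : seq T) : a ++ b = c ++ d ->
  (exists2 e, c = a ++ e & b = e ++ d) \/ (exists2 e, a = c ++ e & d = e ++ b).
Proof.
elim: a c => [|x a IHa] [|y c] /=; first by move=> ->; left; exists [::].
- by move=> ->; left; exists (y :: c).
- by move=> <-; right; exists (x :: a).
by case=> -> /IHa[] [e -> ->]; [left | right]; exists e.
Qed.

Lemma prefix_catP (T : eqType) (w a b : seq T) :
  prefix w (a ++ b) -> size a <= size w -> exists2 w', w = a ++ w' & prefix w' b.
Proof.
move=> /prefixP[r /cat_eq_cases[[e -> ->]|[e -> _]]] le_aw.
  by exists e => //; apply: prefix_prefix.
exists [::]; last exact: prefix0s.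
by move: le_aw; rewrite size_cat; case: e => [|x e] /=; rewrite ?cats0 //; lia.
Qed.

(** A letterwise map sends squares to squares. The maps used are projections of letters and
    decoders. *)
Lemma nonrep_map_inv (T T' : eqType) (f : T -> T') (s : seq T) :
  nonrepetitive (map f s) -> nonrepetitive s.
Proof.
move=> /nonrepP nr; apply/nonrepP => x x_nnil; apply/negP => /infixP[p [q def_s]].
suff : infix (map f x ++ map f x) (map f s) by apply/negP/nr; case: x x_nnil {def_s}.
by rewrite def_s !map_cat -map_cat infix_infix.
Qed.

(** * Words with separators *)

Section Separators.
Context {T L : eqType}.
(** A block is a label with a word. [S] is the separator, [Q] selects the admissible blocks, and [D]
    initial letters suffice to read a label. *)
Variables (S : seq T) (D : nat) (Q : L * seq T -> Prop).
Implicit Types (p q : L * seq T) (bs : seq (L * seq T)).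

Definition glue bs : seq T := flatten [seq S ++ p.2 | p <- bs].

Definition sepword bs : seq T := glue bs ++ S.

Definition revblock p := (p.1, rev p.2).

Definition revblocks bs := [seq revblock p | p <- rev bs].

Lemma glue_cons p bs : glue (p :: bs) = S ++ p.2 ++ glue bs.
Proof. by rewrite /glue /= -catA. Qed.

Lemma glue_cat bs1 bs2 : glue (bs1 ++ bs2) = glue bs1 ++ glue bs2.
Proof. by rewrite /glue map_cat flatten_cat. Qed.

Lemma sepword_cons p bs : sepword (p :: bs) = S ++ p.2 ++ sepword bs.
Proof. by rewrite /sepword glue_cons -!catA. Qed.

Lemma sepword_cat bs1 bs2 : sepword (bs1 ++ bs2) = glue bs1 ++ sepword bs2.
Proof. by rewrite /sepword glue_cat catA. Qed.

Lemma sepwordE bs : exists r, sepword bs = S ++ r.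
Proof.
case: bs => [|p bs]; first by exists [::]; rewrite cats0.
by rewrite sepword_cons; eexists.
Qed.

Lemma infix_sepword bs1 bs2 : infix bs1 bs2 -> infix (sepword bs1) (sepword bs2).
Proof.
move=> /infixP[l [r ->]]; rewrite !sepword_cat.
have [t ->] := sepwordE r.
by rewrite [glue bs1 ++ S ++ t]catA infix_infix.
Qed.

Lemma revblocksK : involutive revblocks.
Proof.
move=> bs; rewrite /revblocks -map_rev revK -map_comp map_id_in // => -[a v] _.
by rewrite /= /revblock /= revK.
Qed.

Lemma unzip1_revblocks bs : unzip1 (revblocks bs) = rev (unzip1 bs).
Proof. by rewrite /unzip1 /revblocks -map_comp map_rev. Qed.

Lemma revblocks_cat bs1 bs2 :
  revblocks (bs1 ++ bs2) = revblocks bs2 ++ revblocks bs1.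
Proof. by rewrite /revblocks rev_cat map_cat. Qed.

Lemma size_revblocks bs : size (revblocks bs) = size bs.
Proof. by rewrite size_map size_rev. Qed.

Hypothesis D_gt0 : 0 < D.
Hypothesis S_nnil : S <> [::].
Hypothesis S_pal : rev S = S.

Lemma rev_sepword bs : rev (sepword bs) = sepword (revblocks bs).
Proof.
elim: bs => [|p bs IHbs]; first by rewrite /sepword /= S_pal.
rewrite sepword_cons catA rev_cat IHbs rev_cat S_pal -[p :: bs]cat1s revblocks_cat.
by rewrite sepword_cat /sepword glue_cons /= -!catA.
Qed.

Hypothesis Q_sync : forall p A C, Q p -> S ++ p.2 ++ S = A ++ S ++ C -> A = [::] \/ C = [::].
Hypothesis Q_rev : forall p, Q p -> Q (revblock p).
(** A word of length at least [2 * D - 1] cut in two keeps [D] letters on one side; with [Q_rev] the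
    label can be read from either end. *)
Hypothesis Q_size : forall p, Q p -> D.*2 <= (size p.2).+1.
Hypothesis Q_label : forall p q, Q p -> Q q -> take D p.2 = take D q.2 -> p.1 = q.1.

Let Qall bs := forall p, p \in bs -> Q p.

(** By [Q_sync], [S] occurs in the word only as a separator, so every occurrence cuts the list of
    blocks. *)
Lemma sepword_split bs A C : Qall bs -> sepword bs = A ++ S ++ C ->
  exists bs1 bs2, [/\ bs = bs1 ++ bs2, glue bs1 = A & sepword bs2 = S ++ C].
Proof.
elim: bs A => [|p bs IHbs] A Qbs def_bs.
  have [A0 C0]: A = [::] /\ C = [::].
    move/(congr1 size): def_bs; rewrite /sepword /= !size_cat.
    by case: (A) (C) => [|? ?] [|? ?] //=; lia.
  by exists [::], [::]; split; rewrite ?A0 ?C0 ?cats0.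
have Qp : Q p by apply: Qbs; rewrite mem_head.
have [A_0 | A_nnil] := eqVneq A [::].
  by exists [::], (p :: bs); split; rewrite ?def_bs ?A_0.
have [[e def_A def_C]|[e def_p def_C]] : (exists2 e, A = (S ++ p.2) ++ e & sepword bs = e ++ S ++ C)
    \/ (exists2 e, S ++ p.2 = A ++ e & S ++ C = e ++ sepword bs).
- by apply: cat_eq_cases; rewrite -catA -sepword_cons.
- have [|bs1 [bs2 [-> def1 def2]]] := IHbs e _ def_C.
    by move=> q q_bs; apply: Qbs; rewrite in_cons q_bs orbT.
  by exists (p :: bs1), bs2; rewrite glue_cons def1 def_A catA.
have [r def_r] := sepwordE bs.
have [e0|e_nnil] := eqVneq e [::].
  have [//||bs1 [bs2 [-> def1 def2]]] := IHbs [::].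
  - by move=> q q_bs; apply: Qbs; rewrite in_cons q_bs orbT.
  - by rewrite def_C e0.
  by exists (p :: bs1), bs2; rewrite glue_cons def1 cats0 def_p e0 cats0.
(* The occurrence of [S] starts inside [S ++ p.2], hence ends inside [S ++ p.2 ++ S], where [Q_sync]
   applies. *)
have [C' def_C']: exists C', e ++ S = S ++ C'.
  case: (@cat_eq_cases _ (e ++ S) r S C); first by rewrite def_C def_r catA.
    by case=> e' /(congr1 size); case: (e) e_nnil => //= x e2 _; rewrite !size_cat; lia.
  by case=> C' -> _; exists C'.
have [] := @Q_sync p A C' Qp.
- by rewrite catA def_p -catA def_C'.
- by move/eqP; rewrite (negPf A_nnil).
move=> C'0; move/(congr1 size): def_C'; rewrite C'0 cats0 size_cat.
by case: (e) e_nnil => //= x e2 _; lia.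
Qed.

(** When [w] is read from the left in both words, a block showing [D] letters has the same label in
    both; once its closing separator is visible, the two blocks are equal and the reading goes on.
    It stops when [bs1] is exhausted or the next block shows fewer than [D] letters. *)
Lemma common_labels bs1 bs2 w : Qall bs1 -> Qall bs2 ->
    prefix w (sepword bs1) -> prefix w (sepword bs2) ->
  exists n, [/\ n <= size bs1, n <= size bs2,
    take n (unzip1 bs1) = take n (unzip1 bs2) &
    n = size bs1 \/ size w < size (glue (take n bs1)) + size S + D].
Proof.
elim: bs1 bs2 w => [|p bs1 IHbs] bs2 w Q1 Q2 w1 w2.
  by exists 0; split=> //; [rewrite !take0 | left].
have Qp : Q p by apply: Q1; rewrite mem_head.
have Q1' : Qall bs1 by move=> q q_bs; apply: Q1; rewrite in_cons q_bs orbT.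
have [lt_w|le_w] := ltnP (size w) (size S + D).
  by exists 0; split=> //; [rewrite !take0 | right].
have [w' def_w w'1] : exists2 w', w = S ++ w' & prefix w' (p.2 ++ sepword bs1).
  by apply: prefix_catP; [rewrite -sepword_cons | lia].
have [q [bs2' def2]] : exists q, exists bs2', bs2 = q :: bs2'.
  case: bs2 w2 {Q2} => [/size_prefix|q bs2' _]; last by exists q, bs2'.
  by rewrite /sepword /=; lia.
subst bs2.
have Qq : Q q by apply: Q2; rewrite mem_head.
have w'2 : prefix w' (q.2 ++ sepword bs2').
  have [||w'' def_w'' w''2] := @prefix_catP _ w S (q.2 ++ sepword bs2').
  - by rewrite -sepword_cons.
  - by lia.
  by move/eqP: def_w''; rewrite def_w eqseq_cat // eqxx /= => /eqP->.
have eq1 : p.1 = q.1.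
  have takeD (s : seq T) p' : prefix w' (p'.2 ++ s) -> Q p' -> take D w' = take D p'.2.
    move=> /prefixP[r def_r] /Q_size szp.
    have := congr1 (take D) def_r; rewrite !takel_cat //; last by lia.
    by move: le_w; rewrite def_w size_cat; lia.
  by apply: Q_label => //; rewrite -(takeD _ _ w'1 Qp) (takeD _ _ w'2 Qq).
have [lt_w2|le_w2] := ltnP (size w) (size (S ++ p.2 ++ S)).
  exists 1; split=> //=; first by rewrite !take0 eq1.
  by right; rewrite take0 glue_cons cats0; move: lt_w2; rewrite !size_cat; lia.
have [r1 def_r1] := sepwordE bs1.
have [|w3 def_w3 w3_r1] := @prefix_catP _ w (S ++ p.2 ++ S) r1 _ le_w2.
  by rewrite -!catA -def_r1 -sepword_cons.
have /prefixP[r2 def_r2] := w2.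
have [|b1 [b2 [def_b glue1 sep2]]] := @sepword_split (q :: bs2') (S ++ p.2) (w3 ++ r2) Q2.
  by rewrite def_r2 def_w3 -!catA.
case: b1 def_b glue1 => [|q1 b1] def_b.
  by move/(congr1 size); case: (S) S_nnil.
case: def_b => eq_q def_b; subst q1.
case: b1 def_b => [|q2 b1] def_b.
  rewrite glue_cons cats0 => /eqP; rewrite eqseq_cat // eqxx /= => /eqP eq_pq.
  have Q2' : Qall bs2' by move=> q' q_bs; apply: Q2; rewrite in_cons q_bs orbT.
  have [||n [n1 n2 eqn Hn]] := IHbs bs2' (S ++ w3) Q1' Q2'.
  - by have /prefixP[r def_r] := w3_r1; apply/prefixP; exists r; rewrite def_r1 def_r catA.
  - by rewrite def_b sep2; apply/prefixP; exists r2; rewrite -catA.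
  exists n.+1; split=> //=; first by rewrite eq1 eqn.
  case: Hn => [->|Hn]; [by left | right].
  rewrite glue_cons def_w3; move: Hn; rewrite !size_cat; lia.
(* A further block in [b1] would put a separator strictly inside [S ++ p.2 ++ S]. *)
rewrite !glue_cons => def_p.
have [] := @Q_sync p (S ++ q.2) (q2.2 ++ glue b1 ++ S) Qp.
- by rewrite catA -def_p -!catA.
- by move/(congr1 size); case: (S) S_nnil.
move/(congr1 size); rewrite !size_cat; case: (S) S_nnil => //= ? ?; lia.
Qed.

(** The centre of the square cuts at most one of the two disjoint occurrences. *)
Lemma two_occurrences (x a b c : seq T) :
  x ++ x = a ++ S ++ b ++ S ++ c -> infix S x.
Proof.
rewrite [a ++ _]catA => /cat_eq_cases[[e _ ->]|[e -> _]].
  by rewrite [e ++ _]catA infix_infix.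
by rewrite -catA infix_infix.
Qed.

(** A square reaching beyond two blocks contains a block together with both its separators, and then
    [two_occurrences] puts [S] inside [x]. *)
Lemma square_local bs x : infix (x ++ x) (sepword bs) -> ~~ infix S x ->
  exists bs', [/\ infix bs' bs, size bs' <= 2 & infix (x ++ x) (sepword bs')].
Proof.
move=> xx_bs S_x; elim: bs xx_bs => [|p [|q bs] IHbs] xx_bs.
- by exists [::].
- by exists [:: p]; rewrite infix_refl.
have /infixP[l [r def_bs]] := xx_bs; rewrite sepword_cons in def_bs.
have [|[e _ def2]|[e def1 def2]] := @cat_eq_cases _ (S ++ p.2) (sepword (q :: bs)) l (x ++ x ++ r).
- by rewrite -catA def_bs -catA.
- have [|bs' [bs'_bs sz_bs' xx_bs']] := IHbs.
    by rewrite def2 [x ++ x ++ r]catA infix_infix.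
  by exists bs'; split=> //; apply: infix_trans bs'_bs (infix_cons _ _).
have [r' def_r'] := sepwordE bs.
have [|[e2 def3 _]|[e2 def3 _]] := @cat_eq_cases _ (x ++ x) r (e ++ S ++ q.2 ++ S) r'.
- by rewrite -!catA -def_r' -sepword_cons -def2 catA.
- exists [:: p; q]; split=> //.
    by rewrite (_ : p :: q :: bs = [::] ++ [:: p; q] ++ bs) // infix_infix.
  rewrite !sepword_cons /sepword /= catA def1 -catA def3 -!catA.
  by rewrite [x ++ x ++ e2]catA infix_infix.
by case/negP: S_x; apply: (@two_occurrences x e q.2 e2); rewrite def3 -!catA.
Qed.

Lemma size_glue_revblocks bs : size (glue (revblocks bs)) = size (glue bs).
Proof.
have := congr1 size (rev_sepword bs); rewrite size_rev /sepword !size_cat; lia.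
Qed.

Lemma size_glue_drop n bs : size (glue (drop n bs)) <= size (glue bs).
Proof. by rewrite -{2}(cat_take_drop n bs) glue_cat size_cat leq_addl. Qed.

(** If [x = x1 ++ S ++ x2], the copies of [S] in the two halves cut [bs] into [b1], [b3] and [b4].
    Forwards, [b3] and [b4] share [S ++ x2]; backwards, [b3] and [b1] share [x1 ++ S]. The labels
    read in the two directions cover [b3] and yield a square of labels. *)
Theorem sepword_nonrep bs : Qall bs -> nonrepetitive (unzip1 bs) ->
    (forall bs' x, infix bs' bs -> size bs' <= 2 -> x <> [::] ->
      infix (x ++ x) (sepword bs') -> infix S x) ->
  nonrepetitive (sepword bs).
Proof.
move=> Qbs nr_bs loc; apply/nonrepP => x x_nnil; apply/negP => xx_bs.
have [/infixP[x1 [x2 def_x]]|S_x] := boolP (infix S x); last first.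
  have [bs' [bs'_bs sz_bs' xx_bs']] := square_local xx_bs S_x.
  by case/negP: S_x; apply: loc xx_bs'.
have /infixP[l [r def_bs]] := xx_bs.
have [|b1 [b2 [def_b12 glue1 sep2]]] :=
  @sepword_split bs (l ++ x1) (x2 ++ x1 ++ S ++ x2 ++ r) Qbs.
  by rewrite def_bs def_x -!catA.
have Qb2 : Qall b2 by move=> p p_b; apply: Qbs; rewrite def_b12 mem_cat p_b orbT.
have [|b3 [b4 [def_b34 glue3 sep4]]] := @sepword_split b2 (S ++ x2 ++ x1) (x2 ++ r) Qb2.
  by rewrite sep2 -!catA.
have Qb1 : Qall b1 by move=> p p_b; apply: Qbs; rewrite def_b12 mem_cat p_b.
have Qb3 : Qall b3 by move=> p p_b; apply: Qb2; rewrite def_b34 mem_cat p_b.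
have Qb4 : Qall b4 by move=> p p_b; apply: Qb2; rewrite def_b34 mem_cat p_b orbT.
have Qrev b : Qall b -> Qall (revblocks b).
  by move=> Qb p /mapP[q]; rewrite mem_rev => /Qb/Q_rev Qq ->.
have [||n [n3 n4 eq_n Hn]] := @common_labels b3 b4 (S ++ x2) Qb3 Qb4.
- by rewrite /sepword glue3 -!catA catA prefix_prefix.
- by rewrite sep4 catA prefix_prefix.
have [||n' [n'3 n'1 eq_n' Hn']] :=
    @common_labels (revblocks b3) (revblocks b1) (S ++ rev x1) (Qrev _ Qb3) (Qrev _ Qb1).
- by rewrite -rev_sepword /sepword glue3 !rev_cat S_pal -?catA [S ++ rev x1 ++ _]catA prefix_prefix.
- by rewrite -rev_sepword /sepword glue1 !rev_cat S_pal -?catA [S ++ rev x1 ++ _]catA prefix_prefix.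
rewrite !size_revblocks in n'3 n'1 Hn'.
(* Otherwise the block of [b3] at index [n] is read in neither direction, so it shows fewer than [D]
   letters on each side of the centre of the square, against [Q_size]. *)
have le_nn' : size b3 <= n + n'.
  rewrite leqNgt; apply/negP => lt_nn'.
  case: Hn => [|Hn]; first lia.
  case: Hn' => [|Hn']; first lia.
  have p0 : L * seq T by case: (b3) lt_nn'.
  have Qp : Q (nth p0 b3 n) by apply/Qb3/mem_nth/(leq_ltn_trans _ lt_nn')/leq_addr.
  have := Q_size Qp; set p := nth p0 b3 n => Dp.
  have sz3 : size (glue b3) =
      size (glue (take n b3)) + size S + size p.2 + size (glue (drop n.+1 b3)).
    rewrite -{1}(cat_take_drop n b3) (drop_nth p0); last lia.
    by rewrite glue_cat glue_cons !size_cat /p; lia.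
  have sz3' : size (glue (take n' (revblocks b3))) <= size (glue (drop n.+1 b3)).
    have -> : take n' (revblocks b3) = revblocks (drop (size b3 - n') b3).
      by rewrite /revblocks -map_take take_rev.
    rewrite size_glue_revblocks (_ : size b3 - n' = (size b3 - n' - n.+1) + n.+1); last lia.
    by rewrite -drop_drop size_glue_drop.
  have : size (glue b3) = size S + size x2 + size x1 by rewrite glue3 !size_cat; lia.
  by rewrite !size_cat size_rev in Hn Hn'; lia.
(* The labels of [b1], [b3] and [b4] end with [Y], are [X ++ Y] and start with [X]. *)
set l1 := unzip1 b1; set l3 := unzip1 b3; set l4 := unzip1 b4.
have sz3 : size l3 = size b3 by rewrite size_map.
pose X := take (size l3 - n') l3; pose Y := drop (size l3 - n') l3.
have defX : X = take (size l3 - n') l4.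
  have := congr1 (take (size l3 - n')) eq_n.
  by rewrite !take_takel //; lia.
have defY : Y = drop (size l1 - n') l1.
  by apply: (can_inj revK); rewrite -!take_rev /l1 /l3 -!unzip1_revblocks.
have XY_nnil : Y ++ X <> [::].
  move/(congr1 size); rewrite size_cat addnC -size_cat cat_take_drop sz3.
  by move/size0nil => b3_0; move: glue3; rewrite b3_0 => /(congr1 size); case: (S) S_nnil.
move/nonrepP/(_ (Y ++ X) XY_nnil)/negP: nr_bs; apply.
suff -> : unzip1 bs = take (size l1 - n') l1 ++
    ((Y ++ X) ++ (Y ++ X)) ++ drop (size l3 - n') l4 by rewrite infix_infix.
have e1 : l1 = take (size l1 - n') l1 ++ Y by rewrite defY cat_take_drop.
have e3 : l3 = X ++ Y by rewrite cat_take_drop.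
have e4 : l4 = X ++ drop (size l3 - n') l4 by rewrite defX cat_take_drop.
transitivity (l1 ++ l3 ++ l4); first by rewrite def_b12 def_b34 /unzip1 !map_cat.
by rewrite [in LHS]e1 [in LHS]e3 [in LHS]e4 -!catA.
Qed.

End Separators.

(** * A ternary substitution *)

Definition sep : seq nat := [:: 1; 0; 2; 1; 2; 0; 1].

Definition branch_word : seq nat :=
  [:: 0; 2; 0; 1; 2; 0; 2; 1; 0; 1; 2; 1; 0; 2; 0; 1; 2; 1; 0; 1; 2; 0; 2; 1; 0; 2; 0].

(* Found by computer search, as the long words. *)
Definition short_words : seq (seq nat) := [::
  [:: 0; 2; 0; 1; 2; 1; 0; 1; 2; 0; 1; 0; 2; 0; 1; 2; 0; 2; 1; 0; 1; 2; 1; 0; 2; 0];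
  [:: 0; 2; 0; 1; 2; 0; 2; 1; 0; 2; 0; 1; 0; 2; 1; 2; 0; 2; 1; 0; 1; 2; 1; 0; 2; 0];
  [:: 2; 1; 0; 1; 2; 0; 2; 1; 0; 1; 2; 1; 0; 2; 0; 1; 0; 2; 1; 2; 0; 2; 1; 0; 1; 2];
  [:: 2; 1; 0; 1; 2; 0; 1; 0; 2; 0; 1; 2; 0; 2; 1; 0; 1; 2; 0; 1; 0; 2; 1; 0; 1; 2];
  [:: 2; 1; 0; 2; 0; 1; 2; 0; 2; 1; 0; 1; 2; 1; 0; 2; 1; 2; 0; 2; 1; 0; 2; 0; 1; 2];
  [:: 2; 1; 0; 2; 0; 1; 0; 2; 1; 0; 1; 2; 1; 0; 2; 0; 1; 2; 0; 2; 1; 0; 2; 0; 1; 2]].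

Definition long_words : seq (seq nat) := [::
  [:: 0; 2; 0; 1; 2; 1; 0; 1; 2; 0; 2; 1; 0; 2; 0; 1; 2; 0; 2; 1; 0; 1; 2; 1; 0; 2; 0];
  [:: 0; 2; 0; 1; 2; 0; 2; 1; 0; 1; 2; 0; 1; 0; 2; 1; 2; 0; 2; 1; 0; 1; 2; 1; 0; 2; 0];
  [:: 0; 2; 0; 1; 2; 0; 2; 1; 2; 0; 1; 2; 1; 0; 2; 0; 1; 0; 2; 1; 2; 0; 2; 1; 0; 1; 2];
  [:: 2; 1; 0; 1; 2; 0; 1; 0; 2; 1; 0; 1; 2; 0; 2; 1; 0; 2; 0; 1; 2; 0; 2; 1; 0; 1; 2];
  [:: 2; 1; 0; 2; 0; 1; 2; 0; 2; 1; 0; 1; 2; 0; 1; 0; 2; 1; 2; 0; 2; 1; 0; 2; 0; 1; 2];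
  [:: 0; 2; 0; 1; 2; 1; 0; 2; 0; 1; 0; 2; 1; 2; 0; 2; 1; 0; 1; 2; 0; 1; 0; 2; 0; 1; 2]].

(** [None] stands for a vertex of the original graph; [Some (t, b)] pairs a letter of a ternary
    square-free word with a bit of a code. *)
Notation letter := (option (nat * bool)).

Definition letter_block (long : bool) (a : nat * bool) : letter * seq nat :=
  (Some a, nth [::] (if long then long_words else short_words) (a.1 + 3 * a.2)).

Definition branch_block : letter * seq nat := (None, branch_word).

(** Reversed blocks are included since an edge may be traversed in either direction. *)
Definition block_table : seq (letter * seq nat) :=
  let base := branch_block :: [seq letter_block long a |
    long <- [:: false; true], a <- [seq (t, b) | t <- iota 0 3, b <- [:: false; true]]] in
  base ++ map (@revblock _ _) base.

(** The positions tested, 1 to [size p.2 + 6], are all those where [sep] fits except the first and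
    the last. *)
Lemma block_table_sep : all (fun p =>
  all (fun i => take 7 (drop i.+1 (sep ++ p.2 ++ sep)) != sep) (iota 0 (size p.2 + 6)))
  block_table.
Proof. by vm_compute. Qed.

Lemma block_table_label : all (fun p => all (fun q =>
  (p.1 == q.1) || ~~ eq_upto 13 p.2 q.2) block_table) block_table.
Proof. by vm_compute. Qed.

(** Equal labels are left out: neighbours in a square-free sequence of labels differ. *)
Lemma block_table_nonrep : all (fun p => all (fun q =>
  (p.1 == q.1) || nonrepb (sepword sep [:: p; q])) block_table) block_table.
Proof. by vm_compute. Qed.

Lemma block_table_letters : all (fun p => all (fun c => c < 3) p.2) block_table.
Proof. by vm_compute. Qed.

Lemma letter_block_table long a : a.1 < 3 -> letter_block long a \in block_table.
Proof.
by case: a => -[|[|[|//]]] [] _; case: long; vm_compute.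
Qed.

Lemma branch_block_table : branch_block \in block_table.
Proof. by vm_compute. Qed.

Lemma revblock_table p : p \in block_table -> revblock p \in block_table.
Proof.
by move: p; apply/allP; vm_compute.
Qed.

Lemma eq_uptoE (T : eqType) m (s t : seq T) :
  m <= size s -> m <= size t -> eq_upto m s t = (take m s == take m t).
Proof.
elim: m s t => [|m IHm] [|x s] [|y t] //= lt_s lt_t; rewrite ?take0 ?eqxx //.
by rewrite eqseq_cons -IHm //; case: (x == y).
Qed.

Theorem block_sepword_nonrep bs : {subset bs <= block_table} ->
  nonrepetitive (unzip1 bs) -> nonrepetitive (sepword sep bs).
Proof.
move=> bs_tab nr_bs.
have szt : all (fun p => 25 <= size p.2 <= 27) block_table by vm_compute.
(* All words of the table have length at least 25, so [D = 13] satisfies [Q_size]. *)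
apply: (@sepword_nonrep _ _ sep 13 (fun p => p \in block_table)) => //.
- move=> p A C p_tab def_p; have /allP/(_ p p_tab)/allP sync_p := block_table_sep.
  case: A def_p => [|a A] def_p; first by left.
  case/lastP: C def_p => [|C c] def_p; [by right | exfalso].
  have szp := congr1 size def_p.
  have /sync_p : size A \in iota 0 (size p.2 + 6).
    rewrite mem_iota; move: szp; rewrite !size_cat size_rcons /=; lia.
  rewrite def_p -[drop _ _]/(drop (size (a :: A)) _) drop_size_cat //.
  by rewrite take_size_cat ?eqxx.
- exact: revblock_table.
- move=> p /(allP szt) /=; lia.
- move=> p q p_tab q_tab eq_pq.
  have /allP/(_ p p_tab)/allP/(_ q q_tab)/orP[/eqP //|] := block_table_label.
  rewrite eq_uptoE ?eq_pq ?eqxx //.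
    by have := allP szt p p_tab; rewrite /=; lia.
  by have := allP szt q q_tab; rewrite /=; lia.
move=> bs' x bs'_bs sz_bs' x_nnil xx_bs'; exfalso.
(* A single block is completed by a neighbour with another label, so that the table of pairs applies
   to it. *)
suff [bs2 bs'2 nr2] : exists2 bs2, infix bs' bs2 & nonrepb (sepword sep bs2).
  have /nonrepP/(_ x x_nnil)/negP[] := nonrepbP nr2.
  by apply: infix_trans xx_bs' (infix_sepword _ bs'2).
have nr_pq p q : p \in block_table -> q \in block_table -> p.1 != q.1 ->
    nonrepb (sepword sep [:: p; q]).
  move=> p_tab q_tab /negPf ne_pq.
  by have /allP/(_ p p_tab)/allP/(_ q q_tab) := block_table_nonrep; rewrite ne_pq.
have bs'_tab : {subset bs' <= block_table}.
  by move=> p /(mem_infix bs'_bs)/bs_tab.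
case: bs' bs'_bs sz_bs' {xx_bs'} bs'_tab => [|p [|q [|//]]] bs'_bs _ bs'_tab.
- by exists [::] => //; vm_compute.
- have p_tab := bs'_tab p (mem_head _ _).
  have [p_None|p_Some] := eqVneq p.1 None.
    exists [:: p; letter_block false (0, false)]; first exact: (prefix_infix [:: p]).
    by apply: nr_pq; rewrite ?letter_block_table ?p_None.
  exists [:: p; branch_block]; first exact: (prefix_infix [:: p]).
  by apply: nr_pq; rewrite ?branch_block_table.
exists [:: p; q]; first exact: infix_refl.
apply: nr_pq; try (by apply: bs'_tab; rewrite !inE eqxx ?orbT).
apply: (@nonrep_cons_neq _ _ _ [::]).
apply: nonrep_infix nr_bs; have /infixP[l [r ->]] := bs'_bs.
by rewrite /unzip1 !map_cat infix_infix.
Qed.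

Lemma sepword_letters bs : {subset bs <= block_table} ->
  all (fun c => c < 3) (sepword sep bs).
Proof.
elim: bs => [|p bs IHbs] bs_tab //; rewrite sepword_cons 2!all_cat /=.
rewrite (allP block_table_letters) ?bs_tab ?mem_head //=.
by apply: IHbs => q q_bs; rewrite bs_tab // in_cons q_bs orbT.
Qed.

(** The same substitution, restricted to short words and bit [false], sends a ternary square-free
    word to a longer one. *)
Lemma ternary_square_free n : exists t : seq nat,
  [/\ size t = n, all (fun c => c < 3) t & nonrepetitive t].
Proof.
elim: n => [|n [t [sz_t t_lt3 nr_t]]].
  by exists [::]; split=> //; apply: nonrepbP.
pose bs := [seq letter_block false (c, false) | c <- t].
have bs_tab : {subset bs <= block_table}.
  by move=> p /mapP[c /(allP t_lt3) c_lt3 ->]; apply: letter_block_table.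
exists (take n.+1 (sepword sep bs)); split.
- have : size t <= size (glue sep bs).
    rewrite /bs; elim: (t) => // c t' IHt; rewrite map_cons glue_cons 2!size_cat addnA.
    exact: (@leq_add 1 _ _ _ (ltn0Sn _) IHt).
  by move=> le_t; rewrite size_takel // size_cat -sz_t -addn1 leq_add.
- apply/allP => c /mem_take; exact: (allP (sepword_letters bs_tab)).
apply: (nonrep_infix (infix_take _ _)); apply: block_sepword_nonrep => //.
apply: (@nonrep_map_inv _ _ (fun a => if a is Some b then b.1 else 0)).
by rewrite /bs /unzip1 -!map_comp (eq_map (g := id)) ?map_id.
Qed.

(** * Words coding edge colours *)

(* The code is readable from both ends of the word, so that it can be recovered
   from either half and in either direction of travel. *)
Definition code_word (k : seq bool) (t : seq nat) : seq letter :=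
  map Some (zip t (k ++ nseq (size t - 2 * size k) false ++ rev k)).

(** The ternary component alone makes the word square-free, which leaves the bits free; the length
    condition keeps the two copies of the code from overlapping. *)
Definition carries (k : seq bool) (w : seq letter) : Prop :=
  exists t, [/\ w = code_word k t, 2 * size k <= size t & nonrepetitive t].

Lemma size_code_bits k (t : seq nat) : 2 * size k <= size t ->
  size (k ++ nseq (size t - 2 * size k) false ++ rev k) = size t.
Proof. by rewrite !size_cat size_nseq size_rev; lia. Qed.

Lemma carries_size k w : carries k w -> 2 * size k <= size w.
Proof.
case=> t [-> k_t _]; rewrite size_map size_zip size_code_bits //; lia.
Qed.

Lemma carries_rev k w : carries k w -> carries k (rev w).
Proof.
case=> t [-> k_t nr_t]; exists (rev t); rewrite size_rev; split=> //.
  rewrite /code_word -map_rev rev_zip; last by rewrite size_code_bits.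
  by rewrite size_rev !rev_cat revK rev_nseq catA.
exact: nonrep_rev.
Qed.

Lemma carries_nonrep k w : carries k w -> nonrepetitive w.
Proof.
case=> t [-> k_t nr_t].
apply: (@nonrep_map_inv _ _ (fun a => if a is Some b then b.1 else 0)).
by rewrite -map_comp -/(unzip1 _) unzip1_zip // size_code_bits.
Qed.

Lemma carries_None k w : carries k w -> None \notin w.
Proof. by case=> t [-> _ _]; apply/mapP => -[]. Qed.

Lemma carries_code k w : carries k w ->
  map (fun a => if a is Some b then b.2 else false) (take (size k) w) = k.
Proof.
case=> t [-> k_t _]; rewrite map_take -map_comp -/(unzip2 _).
by rewrite unzip2_zip ?size_code_bits // take_size_cat.
Qed.

Lemma infix_cat_cons (T : eqType) (z : T) (x a b : seq T) : z \notin x ->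
  infix x (a ++ z :: b) -> infix x a || infix x b.
Proof.
move=> z_x /infixP[l [r /esym/cat_eq_cases[]]] [e].
  move=> -> /cat_eq_cases[[e2 -> _]|[e2 def_x]]; first by rewrite infix_infix.
  case: e2 def_x => [-> _|y e2 def_x [eq_zy _]].
    by rewrite cats0 suffix_infix.
  by case/negP: z_x; rewrite def_x eq_zy mem_cat mem_head orbT.
case: e => [_|y e _ [_ ->]]; last by rewrite infix_infix orbT.
case: x z_x => [|y x] z_x; first by rewrite infix0s.
by case=> eq_zy _; rewrite eq_zy mem_head in z_x.
Qed.

(** The separator is the single letter [None], absent from the blocks. The first [B] letters of a
    block spell its label, and a square without [None] lies inside one block, which is
    square-free. *)
Theorem code_sepword_nonrep B (ps : seq (seq bool * seq letter)) : 0 < B ->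
  (forall p, p \in ps -> size p.1 = B /\ carries p.1 p.2) ->
  nonrepetitive (unzip1 ps) -> nonrepetitive (sepword [:: None] ps).
Proof.
move=> B_gt0 code_ps nr_ps.
apply: (@sepword_nonrep _ _ [:: None] B (fun p => size p.1 = B /\ carries p.1 p.2)) => //.
- move=> p A C [_ cp]; case: A => [|a A]; first by left.
  case/lastP: C => [|C c]; [by right | rewrite /= cats1 => -[_]].
  rewrite -rcons_cons -rcons_cat => /rcons_inj[def_p _].
  by have := carries_None cp; rewrite def_p mem_cat mem_head orbT.
- by move=> p [szp cp]; split=> //; apply: carries_rev.
- by move=> p [<- /carries_size] /=; lia.
- move=> p q [szp cp] [szq cq] eq_pq.
  by rewrite -(carries_code cp) szp eq_pq -szq carries_code.
move=> bs' x bs'_bs _ x_nnil; rewrite infix1s; apply: contraTT => None_x.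
have code_bs' p : p \in bs' -> carries p.1 p.2.
  by move=> /(mem_infix bs'_bs)/code_ps[].
apply/negP; elim: bs' {bs'_bs} code_bs' => [|p bs IHbs] code_bs.
  move=> /(@infix_cat_cons _ _ _ [::] [::]); rewrite mem_cat negb_or None_x orbb infixs0.
  by move=> /(_ isT)/eqP; case: x x_nnil {None_x}.
rewrite sepword_cons => /(@infix_cat_cons _ _ _ [::]); rewrite mem_cat negb_or None_x infixs0.
move=> /(_ isT)/orP[/eqP|]; first by case: x x_nnil {IHbs None_x}.
have code_p : carries p.1 p.2 by apply: code_bs; rewrite mem_head.
have [r def_r] := sepwordE [:: None] bs; rewrite def_r => /infix_cat_cons.
rewrite mem_cat negb_or None_x => /(_ isT)/orP[|xx_r].
  by apply/negP; have /nonrepP := carries_nonrep code_p; apply.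
apply: IHbs; first by move=> q q_bs; apply: code_bs; rewrite in_cons q_bs orbT.
by rewrite def_r; apply: infix_catl.
Qed.

(* A vertex of [G] is placed at the centre of the palindrome [branch_word]. *)
Definition branch_color : nat := nth 0 branch_word 13.

Definition half_word : seq nat := take 13 branch_word.

(** The colours inside a subdivided edge: each end vertex is the middle of a [branch_word], so the
    edge starts with the second half of one such word and ends with the first half of another. *)
Definition interior (E : seq (letter * seq nat)) : seq nat :=
  rev half_word ++ sepword sep E ++ half_word.

Lemma rev_interior E : rev (interior E) = interior (revblocks E).
Proof. by rewrite /interior rev_cat (rev_cat (sepword _ _)) revK rev_sepword // catA. Qed.

(** Cutting each [branch_word] at its middle letter turns a word separated by [sep] into one
    separated by [branch_color], up to a fixed piece at each end. *)
Lemma sepword_interior (ps : seq (seq bool * seq (letter * seq nat))) :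
  sepword sep (sepword [:: branch_block] ps) = sep ++ half_word ++
    sepword [:: branch_color] [seq (p.1, interior p.2) | p <- ps] ++ rev half_word ++ sep.
Proof.
elim: ps => [|p ps IHps] //.
rewrite (sepword_cons [:: branch_block]) map_cons (sepword_cons [:: branch_color]).
rewrite [sepword sep _](@sepword_cons _ _ sep branch_block) sepword_cat IHps /interior.
rewrite -[branch_block.2]/(half_word ++ [:: branch_color] ++ rev half_word) /sepword.
by rewrite -!catA.
Qed.

(** The word is a factor of the ternary image of a word separated by [None], so the two levels
    combine. *)
Theorem interior_sepword_nonrep B (ps : seq (seq bool * seq (letter * seq nat))) :
  0 < B ->
  (forall p, p \in ps -> [/\ size p.1 = B, carries p.1 (unzip1 p.2) &
                              {subset p.2 <= block_table}]) ->
  nonrepetitive (unzip1 ps) ->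
  nonrepetitive (sepword [:: branch_color] [seq (p.1, interior p.2) | p <- ps]).
Proof.
move=> B_gt0 ps_ok nr_ps.
suff : nonrepetitive (sepword sep (sepword [:: branch_block] ps)).
  apply: nonrep_infix; rewrite sepword_interior; apply: infix_catl.
  exact: infix_infix.
apply: block_sepword_nonrep.
  elim: ps {nr_ps} ps_ok => [|p ps IHps] ps_ok q.
    by rewrite /sepword /= inE => /eqP->; exact: branch_block_table.
  rewrite (sepword_cons [:: branch_block]) 2!mem_cat => /or3P[].
  - by rewrite inE => /eqP->; exact: branch_block_table.
  - have [_ _ p_tab] := ps_ok p (mem_head _ _); exact: p_tab.
  by apply: IHps => r r_ps; apply: ps_ok; rewrite in_cons r_ps orbT.
have -> : unzip1 (sepword [:: branch_block] ps) =
    sepword [:: None] [seq (p.1, unzip1 p.2) | p <- ps].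
  elim: (ps) => // p ps' IHps; rewrite (sepword_cons [:: branch_block]) map_cons.
  by rewrite (sepword_cons [:: None]) /unzip1 2!map_cat -IHps.
apply: (code_sepword_nonrep B_gt0) => [_ /mapP[p /ps_ok[szp cp _] ->] //|].
by rewrite /unzip1 -map_comp.
Qed.

Lemma ex_edge_blocks (k : seq bool) (l : nat) : 33 + 33 * maxn 33 (2 * size k) <= l ->
  exists E, [/\ {subset E <= block_table}, carries k (unzip1 E) & size (interior E) = l].
Proof.
(* With its separator a short block takes 33 letters and a long one 34; the last separator and the
   two halves of [branch_word] take 33. Hence [n] blocks, the first [j] of them long, give length
   [l]; here [j < 33 <= n]. *)
move=> le_l; pose n := (l - 33) %/ 33; pose j := (l - 33) %% 33.
have def_l : l = 33 + n * 33 + j by rewrite -addnA -divn_eq; lia.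
have lt_j : j < 33 by rewrite ltn_mod.
have [t [sz_t t_lt3 nr_t]] := ternary_square_free n.
have k_t : 2 * size k <= size t by rewrite sz_t; lia.
pose a := zip t (k ++ nseq (size t - 2 * size k) false ++ rev k).
have sz_a : size a = n by rewrite size_zip size_code_bits // minnn.
have a_lt3 (b : nat * bool) : b \in a -> b.1 < 3.
  move=> b_a; apply: (allP t_lt3); have := map_f fst b_a.
  by rewrite -/(unzip1 _) unzip1_zip // size_code_bits.
exists (map (letter_block true) (take j a) ++ map (letter_block false) (drop j a)).
have in_table long (s : seq (nat * bool)) :
    {subset s <= a} -> {subset map (letter_block long) s <= block_table}.
  by move=> s_a p /mapP[b /s_a/a_lt3 b_lt3 ->]; apply: letter_block_table.
split.
- move=> p; rewrite mem_cat => /orP[]; apply: in_table => b; [exact: mem_take | exact: mem_drop].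
- exists t; split=> //; rewrite /unzip1 map_cat -!map_comp /code_word -/a.
  by rewrite -{3}(cat_take_drop j a) map_cat.
have sz_blocks long (s : seq (nat * bool)) : {subset s <= a} ->
    size (glue sep (map (letter_block long) s)) = size s * (33 + long).
  elim: s => // b s IHs s_a; rewrite map_cons glue_cons !size_cat IHs; last first.
    by move=> c c_s; apply: s_a; rewrite in_cons c_s orbT.
  have b_lt3 : b.1 < 3 by apply/a_lt3/s_a/mem_head.
  suff -> : size (letter_block long b).2 = 26 + long by rewrite /=; case: (long); lia.
  by case: (b) b_lt3 => -[|[|[|//]]] [] _; case: (long).
have sz1 : size (take j a) = j by rewrite size_takel // sz_a; lia.
have sz2 : size (drop j a) = n - j by rewrite size_drop sz_a.
rewrite /interior !size_cat size_rev glue_cat size_cat !sz_blocks.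
- by rewrite sz1 sz2 /=; lia.
- by move=> b; exact: mem_drop.
by move=> b; exact: mem_take.
Qed.

(** * Rosenfeld's counting argument *)

Lemma sum_geometric_leq (x : nat -> nat) M K :
  (forall k, 0 < k -> 2 ^ k * x k <= M) -> \sum_(k <- iota 1 K) x k <= M.
Proof.
(* The induction proves the sharper bound [(1 - 2 ^ - K) * M], cleared of denominators. *)
move=> le_x; suff : 2 ^ K * (\sum_(k <- iota 1 K) x k) + M <= 2 ^ K * M.
  by move=> le_K; rewrite -(leq_pmul2l (expn_gt0 2 K)); lia.
elim: K => [|K IHK]; first by rewrite big_nil muln0 mul1n.
rewrite -[K.+1]addn1 iotaD big_cat big_seq1 /= add1n addn1 expnS.
by have := le_x K.+1 isT; rewrite expnS; nia.
Qed.

Lemma card_has_leq (T : finType) (I : Type) (Z : I -> {set T}) (s : seq I) :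
  #|[set g | has (fun i => g \in Z i) s]| <= \sum_(i <- s) #|Z i|.
Proof.
elim: s => [|i s IHs].
  by rewrite big_nil (_ : [set _ | _] = set0) ?cards0 //; apply/setP=> g; rewrite !inE.
rewrite big_cons; apply: leq_trans (leq_add (leqnn _) IHs).
apply: leq_trans (leq_card_setU _ _); apply/subset_leq_card/subsetP => g.
by rewrite !inE.
Qed.

Section Counting.
Context {E : finType}.
(** [N] counts the colours, [beta] is the factor gained with each new element, and the words of a
    bad pair must not be coloured alike. The factor [2 ^ k] in [size_T] lets the forbidden
    extensions of all lengths sum to at most [M] times the number of good colourings. *)
Variables (N beta M : nat) (bad : seq E -> seq E -> Prop).
(* [T e k] lists, among others, the bad pairs of length [k] whose first word contains [e]. *)
Variable T : E -> nat -> seq (seq E * seq E).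

Hypothesis bad_sym : forall h h', bad h h' -> bad h' h.
Hypothesis bad_size : forall h h', bad h h' -> size h = size h' /\ h <> [::].
Hypothesis bad_uniq : forall h h', bad h h' -> uniq (h ++ h').
Hypothesis bad_T : forall e h h', bad h h' -> e \in h -> (h, h') \in T e (size h).
Hypothesis size_T : forall e k, 0 < k -> size (T e k) * 2 ^ k <= M * beta ^ k.-1.
Hypothesis N_ge : beta + M <= N.
Hypothesis beta_gt0 : 0 < beta.

Let N_gt0 : 0 < N. Proof. by lia. Qed.
Let c0 : 'I_N := Ordinal N_gt0.
Implicit Types (A B : {set E}) (f g : {ffun E -> 'I_N}).

Let avoids f A : Prop := forall h h', bad h h' -> {subset h <= A} -> {subset h' <= A} ->
  map f h <> map f h'.

(* A colouring of [A] is a total function with the default colour outside [A]. *)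
Let good A : {set {ffun E -> 'I_N}} :=
  [set f : {ffun E -> 'I_N} | [forall y, (y \notin A) ==> (f y == c0)] && `[< avoids f A >]].

Let goodP f A : reflect ((forall y, y \notin A -> f y = c0) /\ avoids f A) (f \in good A).
Proof.
rewrite inE; apply: (iffP andP) => [[/forallP supp /asboolP av]|[supp av]]; split=> //.
- by move=> y y_A; apply/eqP; move: (supp y); rewrite y_A.
- by apply/forallP => y; apply/implyP => /supp->.
exact/asboolP.
Qed.

Let extend e f x : {ffun E -> 'I_N} := [ffun y => if y == e then x else f y].

Let Z e A (p : seq E * seq E) : {set {ffun E -> 'I_N}} :=
  [set g : {ffun E -> 'I_N} | `[< [/\ bad p.1 p.2, e \in p.1,
                 {subset p.1 <= e |: A} /\ {subset p.2 <= e |: A},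
                 map g p.1 = map g p.2 &
                 exists2 f, f \in good A & exists x, g = extend e f x] >]].

(** The two words of a bad pair are disjoint, so the colours on [p.1] can be recovered from those on
    [p.2]: erasing [p.1] is injective on [Z e A p] and leaves a good colouring of the rest of
    [A]. *)
Let card_Z e A p : e \notin A -> #|Z e A p| <= #|good (A :\: [set y in p.1])|.
Proof.
move=> e_A; pose reset g : {ffun E -> 'I_N} := [ffun y => if y \in p.1 then c0 else g y].
have <- : #|[set reset g | g in Z e A p]| = #|Z e A p|.
  apply: card_in_imset => g g'; rewrite !inE => /asboolP[bad_p _ _ eq_g _] /asboolP[_ _ _ eq_g' _].
  move=> eq_r; have out y : y \notin p.1 -> g y = g' y.
    by move=> /negPf y_p; move/ffunP/(_ y): eq_r; rewrite !ffunE y_p.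
  have : map g p.1 = map g' p.1.
    rewrite eq_g eq_g'; apply/eq_in_map => y y_p; apply: out; apply/negP => y_p1.
    have := bad_uniq bad_p; rewrite cat_uniq => /and3P[_ /hasP[]]; by exists y.
  move=> /eq_in_map eq_in; apply/ffunP => y.
  by have [/eq_in|/out] := boolP (y \in p.1).
apply/subset_leq_card/subsetP => _ /imsetP[g g_Z ->]; move: g_Z.
rewrite inE => /asboolP[bad_p e_p _ _ [f /goodP[supp av] [x ->]]].
have agree y : y \in A :\: [set y in p.1] -> reset (extend e f x) y = f y.
  rewrite !inE => /andP[/negPf y_p y_A]; rewrite !ffunE y_p.
  by case: eqP y_A e_A => // ->  ->.
apply/goodP; split=> [y|h h' bad_h h_A h'_A].
  rewrite !inE negb_and negbK !ffunE; case: ifP => //= y_p y_A.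
  by case: eqP => [y_e|_]; [rewrite y_e e_p in y_p | apply: supp].
rewrite (_ : map _ h = map f h); last by apply/eq_in_map => y /h_A/agree.
rewrite (_ : map _ h' = map f h'); last by apply/eq_in_map => y /h'_A/agree.
by apply: av => // y; [move/h_A | move/h'_A]; rewrite inE => /andP[].
Qed.

Let sub_growth n : (forall e A, #|A| < n -> e \notin A -> beta * #|good A| <= #|good (e |: A)|) ->
  forall A B, #|A| <= n -> B \subset A -> beta ^ (#|A| - #|B|) * #|good B| <= #|good A|.
Proof.
move=> growth A B; move Ed : (#|A| - #|B|) => d; elim: d A Ed => [|d IHd] A Ed le_A sBA.
  have : B == A by rewrite eqEcard sBA; lia.
  by move/eqP=> ->; rewrite mul1n.
have [e]: exists e, e \in A :\: B.
  by apply/set0Pn; rewrite -card_gt0 cardsD (setIidPr sBA) Ed.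
rewrite inE => /andP[e_B e_A]; have cA := cardsD1 e A; rewrite e_A in cA.
have sBA' : B \subset A :\ e.
  by apply/subsetP => y y_B; rewrite !inE (subsetP sBA) // andbT; apply: contraNneq e_B => <-.
have leA' : #|A :\ e| < n by lia.
have := growth e (A :\ e) leA'; rewrite setD1K // !inE eqxx => /(_ isT).
apply: leq_trans; rewrite expnS -mulnA leq_mul2l IHd ?orbT //; first lia.
exact: ltnW.
Qed.

(** Induction on the size of [A]. Erasing a bad word of length [k] through [e] gives up [k - 1]
    elements of [A], each worth a factor [beta] by induction. So at most [M * #|good A|] of the
    [N * #|good A|] extensions are bad, and [N >= beta + M]. *)
Let growth e A : e \notin A -> beta * #|good A| <= #|good (e |: A)|.
Proof.
move En : #|A|.+1 => n.
elim: n {-2}n (leqnn n) e A En => [|n IHn] m le_m e A Em e_A; first by lia.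
have growth e' A' : #|A'| < #|A| -> e' \notin A' -> beta * #|good A'| <= #|good (e' |: A')|.
  by move=> lt_A'; apply: (IHn #|A'|.+1); lia.
have le_Z p : beta ^ (size p.1).-1 * #|Z e A p| <= #|good A|.
  have [->|[g]] := set_0Vmem (Z e A p); first by rewrite cards0 muln0.
  rewrite inE => /asboolP[bad_p e_p [p1_A _] _ _].
  apply: leq_trans (leq_mul (leqnn _) (card_Z p e_A)) _.
  have -> : (size p.1).-1 = #|A| - #|A :\: [set y in p.1]|.
    have := cardsID [set y in p.1] A.
    suff : #|A :&: [set y in p.1]| = (size p.1).-1 by lia.
    have -> : A :&: [set y in p.1] = [set y in p.1] :\ e.
      apply/setP => y; rewrite !inE; case: eqP => [->|/eqP y_e]; first by rewrite (negPf e_A).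
      by case: (boolP (y \in p.1)) => [/p1_A|]; rewrite ?andbF // !inE (negPf y_e) /= => ->.
    have := cardsD1 e [set y in p.1]; rewrite inE e_p cardsE.
    have := bad_uniq bad_p; rewrite cat_uniq => /andP[/card_uniqP -> _]; lia.
  by apply: (sub_growth growth) => //; apply: subsetDl.
pose X := [set extend e u.1 u.2 | u in setX (good A) [set: 'I_N]].
have card_X : #|X| = #|good A| * N.
  rewrite card_in_imset ?cardsX ?cardsT ?card_ord // => -[f x] [f' x'].
  rewrite !in_setX !in_setT !andbT => /goodP[supp _] /goodP[supp' _] /ffunP eq_ext.
  have -> : x = x' by have := eq_ext e; rewrite !ffunE eqxx.
  congr (_, _); apply/ffunP => y; have := eq_ext y; rewrite !ffunE.
  by case: eqP => // -> _; rewrite supp ?supp'.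
pose K := #|E|.
pose Tk k := [seq p <- T e k | size p.1 == k].
pose s := flatten [seq Tk k | k <- iota 1 K].
have sub_X : X \subset good (e |: A) :|: [set g | has (fun p => g \in Z e A p) s].
  apply/subsetP => _ /imsetP[[f x] + ->]; rewrite in_setX in_setT andbT => f_good.
  have /goodP[supp av] := f_good.
  set g := extend e f x; rewrite inE; apply/orP.
  have [g_good|g_bad] := boolP (g \in good (e |: A)); [by left | right].
  have [h [h' [bad_h h_A h'_A eq_h]]] : exists h h', [/\ bad h h',
      {subset h <= e |: A}, {subset h' <= e |: A} & map g h = map g h'].
    apply: contraNP g_bad => no_h; apply/goodP; split=> [y|h h' bad_h h_A h'_A eq_h].
      by rewrite !inE negb_or ffunE => /andP[/negPf-> /supp].
    by case: no_h; exists h, h'.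
  (* A repetition avoiding [e] would already occur in [f]; by symmetry [e] lies in the first
     word. *)
  wlog e_h : h h' bad_h h_A h'_A eq_h / e \in h.
    move=> wl; have [|e_h] := boolP (e \in h); first exact: wl bad_h h_A h'_A eq_h.
    have [|e_h'] := boolP (e \in h'); first exact: wl (bad_sym bad_h) h'_A h_A (esym eq_h).
    have in_A t : {subset t <= e |: A} -> e \notin t -> {subset t <= A} /\ map g t = map f t.
      move=> t_A e_t; have ne y : y \in t -> y != e by apply: contraTneq => ->.
      split=> [y y_t|]; first by have := t_A y y_t; rewrite !inE (negPf (ne _ y_t)).
      by apply/eq_in_map => y /ne/negPf y_e; rewrite ffunE y_e.
    have [h_A1 eq1] := in_A _ h_A e_h; have [h_A2 eq2] := in_A _ h'_A e_h'.
    by case: (av h h' bad_h h_A1 h_A2); rewrite -eq1 -eq2.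
  rewrite inE; apply/hasP; exists (h, h').
    apply/flattenP; exists (Tk (size h)); last by rewrite mem_filter eqxx bad_T.
    apply: map_f; rewrite mem_iota add1n ltnS /K.
    have [_ h_nnil] := bad_size bad_h.
    rewrite lt0n size_eq0; apply/andP; split; first exact/eqP.
    have := bad_uniq bad_h; rewrite cat_uniq => /andP[/card_uniqP <- _].
    exact: max_card.
  by rewrite inE; apply/asboolP; split=> //=; exists f => //; exists x.
have le_X := leq_trans (subset_leq_card sub_X) (leq_card_setU _ _).
have le_s : \sum_(p <- s) #|Z e A p| <= M * #|good A|.
  rewrite /s big_flatten big_map; apply: sum_geometric_leq => k k_gt0.
  have bnd_k : beta ^ k.-1 * \sum_(p <- Tk k) #|Z e A p| <= size (Tk k) * #|good A|.
    rewrite big_distrr /= -sum1_size big_distrl /= big_seq [X in _ <= X]big_seq.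
    apply: leq_sum => p; rewrite mem_filter mul1n => /andP[/eqP <- _]; exact: le_Z.
  have le_Tk : size (Tk k) * 2 ^ k <= M * beta ^ k.-1.
    by apply: leq_trans (size_T e k_gt0); rewrite leq_mul2r size_filter count_size orbT.
  have bk_gt0 : 0 < beta ^ k.-1 by rewrite expn_gt0 beta_gt0.
  rewrite -(leq_pmul2l bk_gt0) mulnCA.
  apply: leq_trans (leq_mul (leqnn _) bnd_k) _.
  by rewrite mulnA mulnCA [in X in _ <= X]mulnA [2 ^ k * _]mulnC leq_mul // [beta ^ _ * M]mulnC.
have := leq_trans le_X (leq_add (leqnn _) (leq_trans (card_has_leq _ _) le_s)).
rewrite card_X mulnC => le_N; rewrite -(leq_add2r (M * #|good A|)) -mulnDl.
exact: leq_trans (leq_mul N_ge (leqnn _)) le_N.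
Qed.

Theorem exists_avoiding_coloring : exists f : E -> nat,
  (forall y, f y < N) /\ forall h h', bad h h' -> map f h <> map f h'.
Proof.
(* Growth starts from the empty set, where the default colouring is good because bad words are
   nonempty. *)
have : 0 < #|good [set: E]|.
  apply: leq_trans (@sub_growth #|E| _ [set: E] set0 _ (sub0set _)).
  - rewrite muln_gt0 expn_gt0 beta_gt0 /=; apply/card_gt0P; exists [ffun=> c0].
    apply/goodP; split=> [y _|h h' bad_h h_0 _]; first by rewrite ffunE.
    have [_] := bad_size bad_h; case: h {bad_h} h_0 => // y h h_0.
    by have := h_0 y (mem_head _ _); rewrite inE.
  - by move=> e A _; apply: growth.
  exact: max_card.
case/card_gt0P => f /goodP[_ av]; exists (fun y => nat_of_ord (f y)); split=> [y|h h' bad_h].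
  exact: ltn_ord.
rewrite (map_comp (@nat_of_ord N) f h) (map_comp (@nat_of_ord N) f h').
by move/(inj_map (@ord_inj N)); apply: av bad_h _ _ => y _; rewrite inE.
Qed.

End Counting.

(** * Edge colourings nonrepetitive along walks *)

Lemma size_flatten_leq (I : eqType) (T : Type) (F : I -> seq T) (s : seq I) b :
  {in s, forall i, size (F i) <= b} -> size (flatten (map F s)) <= size s * b.
Proof.
elim: s => //= i s IHs le_b; rewrite size_cat mulSn leq_add ?le_b ?mem_head //.
by apply: IHs => j j_s; rewrite le_b // in_cons j_s orbT.
Qed.

Lemma set2_eq (T : finType) (a b c d : T) : [set a; b] = [set c; d] ->
  (a = c /\ b = d) \/ (a = d /\ b = c).
Proof.
move=> /setP eq_ab; move: (eq_ab a) (eq_ab b) (eq_ab c) (eq_ab d).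
rewrite !inE !eqxx ?orbT /= => /esym/orP[]/eqP ea /esym/orP[]/eqP eb.
all: subst => //; rewrite ?eqxx ?orbb ?orbT /=; try by [left | right].
- by move=> _ /eqP ->; left.
- by move=> /eqP ->; left.
Qed.

Section Walks.
Variable G : sgraph.
Implicit Types (s : seq G) (u v w : G).

Lemma path_edges_cons u v s : path_edges (u :: v :: s) = [set u; v] :: path_edges (v :: s).
Proof. by []. Qed.

Lemma size_path_edges s : size (path_edges s) = (size s).-1.
Proof. by rewrite size_map size_zip size_behead; case: s => //= _ s; apply/minn_idPr. Qed.

Lemma drop_path_edges n s : drop n (path_edges s) = path_edges (drop n s).
Proof.
elim: n s => [|n IHn] s; first by rewrite !drop0.
case: s => [|u [|v s]]; last exact: IHn (v :: s).
  by [].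
by case: n {IHn} => [|n]; rewrite /path_edges.
Qed.

Lemma take_path_edges n s : take n (path_edges s) = path_edges (take n.+1 s).
Proof.
elim: n s => [|n IHn] s; first by case: s => //= u s; rewrite !take0.
case: s => [|u [|v s]]; [by [] | by [] |].
by rewrite path_edges_cons [LHS]/= IHn.
Qed.

Lemma path_edges_cat u v s t :
  path_edges (rcons s u ++ v :: t) =
  path_edges (rcons s u) ++ [set u; v] :: path_edges (v :: t).
Proof.
elim: s => // w s; case: s => [|w' s] //.
exact: (congr1 (cons [set w; w'])).
Qed.

Lemma path_edges_rev s : path_edges (rev s) = rev (path_edges s).
Proof.
elim: s => // u [|v s] // IHs; rewrite path_edges_cons [RHS]rev_cons -IHs.
by rewrite !rev_cons -[rcons (rcons _ _) _]cats1 path_edges_cat [[set v; u]]setUC -[RHS]cats1.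
Qed.

(* The last condition leaves out the end vertices, which a path of a subdivision need
   not reach. *)
Definition almost_path s : bool :=
  [&& sorted (@adj G) s, sorted [rel e f | e != f] (path_edges s) &
      uniq (behead (take (size s).-1 s))].

Lemma almost_path_drop n s : almost_path s -> almost_path (drop n s).
Proof.
case/and3P=> adj_s ne_s un_s; apply/and3P; split.
- exact: drop_sorted.
- by rewrite -drop_path_edges drop_sorted.
have -> : behead (take (size (drop n s)).-1 (drop n s)) = drop n (behead (take (size s).-1 s)).
  rewrite -!drop1 take_drop size_drop !drop_drop addn1 add1n.
  have [le_n|lt_n] := leqP (size s) n; last by congr (drop _ (take _ s)); lia.
  by rewrite !drop_oversize // size_take; case: ifP; lia.
exact: drop_uniq.
Qed.

Lemma almost_path_take n s : almost_path s -> almost_path (take n s).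
Proof.
case/and3P=> adj_s ne_s un_s; apply/and3P; split.
- exact: take_sorted.
- case: n => [|n]; first by rewrite take0.
  by rewrite -take_path_edges; apply: take_sorted.
have [le_n|lt_n] := leqP (size s) n; first by rewrite (take_oversize le_n).
rewrite size_takel ?take_takel; [|lia|lia].
have -> : behead (take n.-1 s) = take n.-2 (behead (take (size s).-1 s)).
  case: n lt_n => [|[|n]] //= lt_n; rewrite ?take0 //.
  by rewrite -!drop1 take_drop addn1 take_takel //; lia.
exact: take_uniq.
Qed.

Lemma mem_path_edges s e u : e \in path_edges s -> u \in e -> u \in s.
Proof.
by case/mapP=> -[a b] /mem_zip[a_s /mem_behead b_s] -> /=; rewrite !inE => /orP[]/eqP->.
Qed.

Lemma almost_path_rev s : almost_path s -> almost_path (rev s).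
Proof.
case/and3P=> adj_s ne_s un_s; apply/and3P; split.
- by rewrite rev_sorted (eq_sorted (e' := @adj G)) // => u v; rewrite /= adj_sym.
- rewrite path_edges_rev rev_sorted (eq_sorted (e' := [rel e f | e != f])) // => e f.
  by rewrite /= eq_sym.
suff -> : behead (take (size (rev s)).-1 (rev s)) = rev (behead (take (size s).-1 s)).
  by rewrite rev_uniq.
case: s {adj_s ne_s un_s} => [|u [|v s]] //.
by rewrite -!drop1 size_rev take_rev drop_rev size_drop subSnn /= ?drop0 ?subn1.
Qed.

(** Without the last vertex only the first can be repeated. The second vertex then occurs once, so
    the first edge could recur only as the second edge, which would be backtracking. *)
Lemma almost_path_uniq_edges s : almost_path s ->
  uniq (take (size (path_edges s)).-1 (path_edges s)).
Proof.
rewrite size_path_edges take_path_edges; case: s => [|u [|v t]] // ap.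
have ap' : almost_path (u :: take (size t) (v :: t)) := almost_path_take (size t).+1 ap.
have : uniq (take (size t) (v :: t)) by case/and3P: ap.
change (uniq (take (size t) (v :: t)) -> uniq (path_edges (u :: take (size t) (v :: t)))).
move: ap'; case: (take _ _) => [|a [|b m]] // /and3P[_ ne_m _] un_m.
rewrite path_edges_cons cons_uniq path_edges_uniq // andbT.
move: ne_m; rewrite !path_edges_cons inE negb_or => /andP[/= -> _] /=.
case/andP: un_m => a_m _; apply: contra a_m => /mem_path_edges; apply.
by rewrite !inE eqxx orbT.
Qed.

(** Seen from both directions, the edges of a square can coincide only as first and last. The two
    middle edges repeat the colours of these, hence form a square on two distinct edges. *)
Lemma almost_path_no_square (f : {set G} -> nat) :
    (forall s n, almost_path s -> uniq (path_edges s) -> 0 < n ->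
       size (path_edges s) = n + n ->
       map f (take n (path_edges s)) <> map f (drop n (path_edges s))) ->
  forall s, almost_path s -> nonrepetitive (map f (path_edges s)).
Proof.
move=> no_sq s s_ap; apply/nonrepP => x x_nnil; apply/negP => /infixP[l [r def_s]].
have x_gt0 : 0 < size x by case: x x_nnil {def_s}.
pose t := take (size x + size x).+1 (drop (size l) s).
have t_ap : almost_path t by apply/almost_path_take/almost_path_drop.
have {def_s} def_x : map f (path_edges t) = x ++ x.
  rewrite /t -take_path_edges -drop_path_edges map_take map_drop def_s drop_size_cat //.
  by rewrite take_size_cat // size_cat.
have sz_t : size (path_edges t) = size x + size x by rewrite -(size_map f) def_x size_cat.
have [un_t|] := boolP (uniq (path_edges t)).
  apply: (no_sq t (size x)) => //.
  by rewrite map_take map_drop def_x take_size_cat // drop_size_cat.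
have un1 := almost_path_uniq_edges t_ap.
have := almost_path_uniq_edges (almost_path_rev t_ap).
rewrite path_edges_rev size_rev take_rev rev_uniq.
move: t_ap def_x un1; rewrite !sz_t => t_ap def_x un1.
have -> : size x + size x - (size x + size x).-1 = 1 by lia.
case def_e : (path_edges t) => [|e es] // un2.
case/lastP: es def_e un2 => [|es e'] def_e //.
rewrite drop1 [behead _]/= cons_uniq => un2; rewrite un2 andbT negbK mem_rcons inE.
case/orP=> [/eqP eq_e|e_es].
  pose y := nth e (path_edges t).
  have y_lo i : i < size x -> f (y i) = nth 0 x i.
    by move=> lt_i; rewrite -(nth_map e 0) ?sz_t ?ltn_addr // def_x nth_cat lt_i.
  have y_hi i : i < size x -> f (y (size x + i)) = nth 0 x i.
    move=> lt_i; rewrite -(nth_map e 0) ?sz_t ?ltn_add2l // def_x nth_cat.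
    by rewrite ltnNge leq_addr /= addKn.
  have lt_p : (size x).-1 < size x by rewrite prednK.
  have eq_y : f (y (size x).-1) = f (y (size x)).
    have := y_hi 0 x_gt0; rewrite addn0 => ->; rewrite y_lo // -y_hi // -y_lo //.
    have -> : size x + (size x).-1 = (size es).+1.
      by move: sz_t; rewrite def_e /= size_rcons; lia.
    by rewrite /y def_e /= nth_rcons ltnn eqxx eq_e.
  pose t2 := take 3 (drop (size x).-1 t).
  have def_t2 : path_edges t2 = [:: y (size x).-1; y (size x)].
    have lt2 : size x < size x + size x by rewrite -{1}(addn0 (size x)) ltn_add2l.
    rewrite /t2 -take_path_edges -drop_path_edges (drop_nth e) ?sz_t ?ltn_addr //.
    by rewrite prednK // (drop_nth e) ?sz_t //= take0.
  have t2_ap : almost_path t2 by apply/almost_path_take/almost_path_drop.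
  case: (no_sq t2 1 t2_ap); rewrite ?def_t2 //=; last by rewrite eq_y.
  by case/and3P: t2_ap => _; rewrite def_t2 /= inE !andbT.
move: un1; rewrite def_e (_ : (_).-1 = size (e :: es)).
  by rewrite -rcons_cons -cats1 take_size_cat // cons_uniq e_es.
by move: sz_t; rewrite def_e /= size_rcons; lia.
Qed.

Fixpoint walks n v : seq (seq G) :=
  if n is n'.+1 then flatten [seq map (cons v) (walks n' w) | w <- enum (adj v)]
  else [:: [:: v]].

Lemma mem_walks v s : path (@adj G) v s -> v :: s \in walks (size s) v.
Proof.
elim: s v => [|w s IHs] v /=; first by rewrite mem_head.
case/andP=> vw /IHs s_w; apply/flattenP; exists (map (cons v) (walks (size s) w)).
  by apply/mapP; exists w; rewrite // mem_enum.
exact: map_f.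
Qed.

Variable D : nat.
Hypothesis D_gt0 : 0 < D.
Hypothesis degree_le : forall v, #|adj v| <= D.

Lemma size_walks n v : size (walks n v) <= D ^ n.
Proof.
elim: n v => [|n IHn] v //=.
apply: (@leq_trans (size (enum (adj v)) * D ^ n)); first apply: size_flatten_leq.
  by move=> w _; rewrite size_map.
by rewrite expnS -cardE leq_mul.
Qed.

Let halves k i (es : seq {set G}) :=
  if i < k then (take k es, drop k es) else (drop k es, take k es).

Let ends (e : {set G}) : seq (G * G) :=
  if [pick p : G * G | e == [set p.1; p.2]] is Some p then [:: p; (p.2, p.1)] else [::].

(** A repetition of [2 * k] edges through [e] is given by the position of [e], its orientation and a
    walk from each of its ends. *)
Let repetitions (e : {set G}) k :=
  flatten [seq flatten [seq flatten [seq
    [seq halves k i (path_edges (rev l ++ r)) | r <- walks (k + k - i.+1) p.2]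
    | l <- walks i p.1] | p <- ends e] | i <- iota 0 (k + k)].

Let size_repetitions e k : 0 < k -> size (repetitions e k) <= (k + k) * (2 * D ^ (k + k).-1).
Proof.
move=> k_gt0; apply: (@leq_trans (size (iota 0 (k + k)) * (2 * D ^ (k + k).-1))); last first.
  by rewrite size_iota.
apply: size_flatten_leq.
move=> i.
rewrite mem_iota add0n => /= lt_i.
have : size (ends e) <= 2 by rewrite /ends; case: pickP.
move=> le_e; apply: leq_trans (leq_mul le_e (leqnn _)).
apply: size_flatten_leq => p _.
have -> : (k + k).-1 = i + (k + k - i.+1) by lia.
rewrite expnD; apply: leq_trans (leq_mul (size_walks i p.1) (leqnn _)).
by apply: size_flatten_leq => l _; rewrite size_map size_walks.
Qed.

Theorem exists_walk_coloring : exists f : {set G} -> nat,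
  (forall e, f e < 12 * D ^ 2) /\
  forall s, almost_path s -> nonrepetitive (map f (path_edges s)).
Proof.
pose bad (h h' : seq {set G}) := [/\ size h = size h', h <> [::], uniq (h ++ h') &
  exists2 s, almost_path s & path_edges s = h ++ h' \/ path_edges s = h' ++ h].
(* There are at most [4 * k * D ^ (2 * k - 1)] repetitions. With [beta = 4 * D ^ 2] and [M = 8 * D]
   the bound on them reduces to [k <= 2 ^ (k - 1)], and [beta + M <= 12 * D ^ 2]. *)
have [|||||||f [f_lt f_av]] :=
  @exists_avoiding_coloring _ (12 * D ^ 2) (4 * D ^ 2) (8 * D) bad repetitions.
- move=> h h' [sz_h h_nnil un_h [s s_ap def_s]]; split=> //.
  + by case: (h') sz_h => //; case: (h) h_nnil.
  + by rewrite uniq_catC.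
  by exists s => //; case: def_s; [right | left].
- by move=> h h' [].
- by move=> h h' [].
- move=> e h h' [sz_h h_nnil un_h [s s_ap def_s]] e_h; rewrite /repetitions.
  have sz_s : size (path_edges s) = size h + size h.
    by case: def_s => ->; rewrite size_cat sz_h.
  have e_s : e \in path_edges s by case: def_s => ->; rewrite mem_cat e_h ?orbT.
  set i := index e (path_edges s).
  have lt_i : i < size h + size h by rewrite -sz_s index_mem.
  have eq_halves : halves (size h) i (path_edges s) = (h, h').
    rewrite /halves /i; case: def_s => ->.
      by rewrite index_cat e_h index_mem e_h take_size_cat // drop_size_cat.
    have e_h' : e \notin h'.
      move: un_h; rewrite cat_uniq => /and3P[_ /hasPn no_h _].
      by apply/negP => e_h'; have := no_h e e_h'; rewrite /= e_h.
    rewrite index_cat (negPf e_h').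
    by rewrite sz_h ltnNge leq_addr /= take_size_cat // drop_size_cat.
  (* The walk is cut at the edge [e] between [a] and [b]: the reversed left part is a walk from [a],
     the right part one from [b]. *)
  have := drop_index e_s; rewrite -/i drop_path_edges.
  case def_d : (drop i s) => [|a [|b r]] //; rewrite path_edges_cons => -[def_e _].
  have def_s' : s = rcons (take i s) a ++ b :: r by rewrite cat_rcons -def_d cat_take_drop.
  have adj_s : sorted (@adj G) (rcons (take i s) a ++ b :: r).
    by rewrite -def_s'; case/and3P: s_ap.
  have [adj_l adj_r] := cat_sorted2 adj_s.
  have sz_take : size (take i s) = i.
    move: sz_s; rewrite size_path_edges => sz_s.
    by rewrite size_takel //; apply/ltnW/(leq_trans lt_i); rewrite -sz_s leq_pred.
  have sz_r : size r = size h + size h - i.+1.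
    have := congr1 size def_d; rewrite size_drop /= -sz_s size_path_edges subnS => eq_r.
    by rewrite -predn_sub eq_r.
  apply/flattenP; eexists; first by apply: map_f (i) _; rewrite mem_iota.
  have [q q_e [l_walk r_walk]] : exists2 q, q \in ends e &
      a :: rev (take i s) \in walks i q.1 /\ b :: r \in walks (size h + size h - i.+1) q.2.
    exists (a, b) => /=.
      rewrite /ends; case: pickP => [[a' b'] /eqP/= |/(_ (a, b))]; last by rewrite def_e eqxx.
      by rewrite -def_e => /set2_eq[] [-> ->]; rewrite !inE eqxx ?orbT.
    split; last by rewrite -sz_r; apply: mem_walks.
    rewrite -{2}sz_take -(size_rev (take i s)); apply: mem_walks.
    have : sorted (@adj G) (rev (rcons (take i s) a)).
      by rewrite rev_sorted (eq_sorted (e' := @adj G)) // => u v; rewrite /= adj_sym.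
    by rewrite rev_rcons.
  apply/flattenP; eexists; first exact: map_f q_e.
  apply/flattenP; eexists; first exact: map_f l_walk.
  apply/mapP; exists (b :: r) => //.
  by rewrite rev_cons revK -def_s' eq_halves.
- move=> e k k_gt0; apply: leq_trans (leq_mul (size_repetitions e k_gt0) (leqnn _)) _.
  case: k k_gt0 => // k _; rewrite -[k.+1.-1]/k.
  have lt_k : k < 2 ^ k by apply: ltn_expl.
  have -> : (k.+1 + k.+1).-1 = (2 * k).+1 by lia.
  have -> : (4 * D ^ 2) ^ k = 2 ^ k * 2 ^ k * D ^ (2 * k) by rewrite expnMn -expnM -expnMn.
  rewrite !expnS; set X := 2 ^ k; set Y := D ^ (2 * k).
  have -> : (k.+1 + k.+1) * (2 * (D * Y)) * (2 * X) = 8 * D * Y * (k.+1 * X) by ring.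
  have -> : 8 * D * (X * X * Y) = 8 * D * Y * (X * X) by ring.
  by rewrite leq_mul // leq_mul.
- by nia.
- by rewrite muln_gt0 expn_gt0 D_gt0.
exists f; split=> // s; apply: almost_path_no_square => {}s n s_ap un_s n_gt0 sz_s.
apply: f_av; split.
- by rewrite size_takel ?size_drop sz_s ?addnK // leq_addl.
- by move/(congr1 size); rewrite size_takel ?sz_s /=; lia.
- by rewrite cat_take_drop.
by exists s => //; left; rewrite cat_take_drop.
Qed.

End Walks.

(** * Paths of a subdivision *)

Lemma uniq_cat_cons_inj (T : eqType) (y : T) (a b c d : seq T) :
  uniq (a ++ y :: b) -> a ++ y :: b = c ++ y :: d -> a = c /\ b = d.
Proof.
move=> un_ab eq_abcd; have un_cd := un_ab; rewrite eq_abcd in un_cd.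
have idx (s t : seq T) : uniq (s ++ y :: t) -> index y (s ++ y :: t) = size s.
  rewrite cat_uniq => /and3P[_ /hasPn no_s _].
  by rewrite index_cat (negPf (no_s y (mem_head _ _))) /= eqxx addn0.
have sz_ac : size a = size c by rewrite -(idx _ _ un_ab) eq_abcd idx.
by move/eqP: eq_abcd; rewrite eqseq_cat // => /andP[/eqP-> /eqP[]].
Qed.

Section Subdivision.
Variables (G H : sgraph) (b : G -> H) (P : G -> G -> seq H).
Hypothesis sub : is_subdivision b P.
Hypothesis P_nnil : forall v w, adj v w -> P v w <> [::].

Fixpoint expand u (t : seq G) : seq H :=
  if t is w :: t' then b u :: P u w ++ expand w t' else [:: b u].

Lemma expandE u t : exists r, expand u t = b u :: r.
Proof. by case: t => [|w t] /=; eexists. Qed.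

Let segment v w := b v :: rcons (P v w) (b w).

Let segment_uniq v w : adj v w -> uniq (segment v w).
Proof. by move=> /(subdiv_path sub)/andP[]. Qed.

Let segment_rev v w : adj v w -> segment w v = rev (segment v w).
Proof.
by move=> vw; rewrite /segment (subdiv_rev sub vw) rev_cons rev_rcons.
Qed.

Let same_edge v w v' w' y : adj v w -> adj v' w' -> y \in P v w -> y \in P v' w' ->
  (v' = v /\ w' = w) \/ (v' = w /\ w' = v).
Proof.
move=> vw vw' y_vw y_vw'.
have [eq_e|ne_e] := eqVneq [set v'; w'] [set v; w]; first exact: set2_eq.
have /disjointFr/(_ y_vw') := subdiv_disjoint sub vw' vw ne_e.
by rewrite y_vw.
Qed.

(* The path [s] starts on the first edge of the walk, strictly before its second vertex, and
   visits all the inner vertices of the walk after its own first vertex. *)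
Let located (s : seq H) := exists v0 v1 t pre post,
  [/\ expand v0 (v1 :: t) = pre ++ s ++ post, size pre <= size (P v0 v1),
      sorted (@adj G) [:: v0, v1 & t] /\
        sorted [rel e f | e != f] (path_edges [:: v0, v1 & t]),
      uniq (belast v1 t) & {in belast v1 t, forall v, b v \in behead s}].

Let located_cons x y z s : adj x y -> x \notin [:: y, z & s] -> uniq [:: y, z & s] ->
  located [:: y, z & s] -> located [:: x, y, z & s].
Proof.
move=> xy x_s un_s [v0 [v1 [t [pre [post [def_s sz_pre [adj_t ne_t] un_t t_s]]]]]].
have [v [w [vw /infixP[p [q def_vw]]]]] := subdiv_edge sub xy.
have v01 : adj v0 v1 by case/andP: adj_t.
case/lastP: pre => [|pre a] in def_s sz_pre *.
  (* Here [y = b v0], so [x] precedes it on the segment from some [v] to [v0], and the walk is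
     prolonged by [v]. *)
  case: def_s => def_y def_z; subst y.
  case/lastP: q => [|q c] in def_vw *; last first.
    have /rcons_inj[def_vw' _] : rcons (b v :: P v w) (b w) = rcons (p ++ [:: x, b v0 & q]) c.
      by rewrite rcons_cons def_vw rcons_cat.
    have : b v0 \in behead (b v :: P v w).
      by rewrite def_vw'; case: (p) => [|p0 p']; rewrite /= ?mem_cat !inE eqxx ?orbT.
    by rewrite /= (negPf (subdiv_branch sub v0 vw)).
  have /rcons_inj[def_P /(subdiv_inj sub) eq_w] :
      rcons (b v :: P v w) (b w) = rcons (rcons p x) (b v0).
    by rewrite rcons_cons def_vw -cats1 -cats1 -catA.
  subst w; exists v, v0, (v1 :: t), p, post.
  split.
  - rewrite -[LHS]/((b v :: P v v0) ++ expand v0 (v1 :: t)) def_P cat_rcons.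
    by rewrite -[expand _ _]/(b v0 :: P v0 v1 ++ expand v1 t) def_z.
  - by have := congr1 size def_P; rewrite size_rcons /=; lia.
  - split; first by rewrite /= vw.
    change (([set v; v0] != [set v0; v1]) &&
            sorted [rel e f | e != f] (path_edges [:: v0, v1 & t])).
    rewrite ne_t andbT.
    (* Turning back along the edge between [v0] and [v1] would make [x] equal to [z]. *)
    apply/eqP => /set2_eq[][eq_v eq_v']; first by rewrite eq_v adj_irrefl in vw.
    subst v; case/negP: x_s; rewrite !inE; apply/orP; right; apply/orP; left.
    have rev_P := subdiv_rev sub vw.
    case: (lastP (P v1 v0)) (P_nnil vw) def_P rev_P => // r x' _.
    rewrite -rcons_cons => /rcons_inj[_ ->]; rewrite rev_rcons => def_P.
    by move: def_z; rewrite def_P => -[-> _].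
  - rewrite /= un_t andbT; apply/negP => /t_s; rewrite -[behead _]/(z :: s).
    by case/andP: un_s => /negP.
  move=> u; rewrite [belast _ _]/= inE => /orP[/eqP->|/t_s u_s]; first exact: mem_head.
  by rewrite [behead _]/= inE u_s orbT.
(* Now [y] is inside [P v0 v1], and [x] is next to it on the same segment: it is the vertex before
   [y], since the one after [y] is [z]. *)
have [r1 def_01 def_z] : exists2 r1, b v0 :: P v0 v1 = rcons pre a ++ y :: r1 &
    r1 ++ expand v1 t = z :: s ++ post.
  rewrite -[expand _ _]/((b v0 :: P v0 v1) ++ expand v1 t) in def_s.
  case: (cat_eq_cases def_s) => -[e def_e def_e'].
    have /eqP : size e = 0.
      by have := congr1 size def_e; rewrite size_cat /= size_rcons in sz_pre *; lia.
    rewrite size_eq0 => /eqP e0; exfalso.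
    by move: sz_pre; rewrite def_e e0 cats0 /= ltnn.
  case: e def_e def_e' => [|y' r1] def_e def_e'.
    by move: sz_pre; rewrite -[rcons pre a]cats0 -def_e /= ltnn.
  by case: def_e' => ey er; subst y'; exists r1.
have y_01 : y \in P v0 v1.
  have : y \in behead (b v0 :: P v0 v1).
    by rewrite def_01; case: (pre) => [|p0 p']; rewrite /= ?cat_rcons ?mem_cat !inE eqxx ?orbT.
  by [].
have y_vw : y \in P v w.
  have : y \in segment v w by rewrite /segment def_vw mem_cat !inE eqxx !orbT.
  rewrite /segment inE mem_rcons inE => /or3P[/eqP y_b|/eqP y_b|//].
    by rewrite y_b (negPf (subdiv_branch sub v v01)) in y_01.
  by rewrite y_b (negPf (subdiv_branch sub w v01)) in y_01.
have def_seg : segment v0 v1 = rcons pre a ++ y :: rcons r1 (b v1).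
  by rewrite /segment -rcons_cons def_01 rcons_cat rcons_cons.
have un_seg := segment_uniq v01; rewrite def_seg in un_seg.
have [[ev ew]|[ev ew]] := same_edge v01 vw y_01 y_vw; subst v w.
  have [] := @uniq_cat_cons_inj _ y _ _ (rcons p x) q un_seg.
    by rewrite -def_seg cat_rcons.
  move=> /rcons_inj[_ eq_a] _; subst a.
  exists v0, v1, t, pre, post; split=> //.
  - by rewrite def_s cat_rcons.
  - by move: sz_pre; rewrite size_rcons => /ltnW.
  by move=> u /t_s u_s; rewrite [behead _]/= in_cons u_s orbT.
have [] := @uniq_cat_cons_inj _ y _ _ (rev q) (x :: rev p) un_seg.
  by rewrite -def_seg (segment_rev vw) /segment def_vw rev_cat !rev_cons -!cats1 -!catA.
move=> _ def_x; case/negP: x_s.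
have [r def_e] := expandE v1 t; rewrite def_e in def_z.
case: r1 def_x def_z {def_01 def_seg un_seg} => [|z' r1] /= [-> _] [-> _].
  by rewrite !inE eqxx orbT.
by rewrite !inE eqxx orbT.
Qed.

Theorem path_in_expand s : gpath s -> 1 < size s ->
  exists u t, almost_path (u :: t) /\ infix s (expand u t).
Proof.
move=> /andP[adj_s un_s] sz_s.
have [v0 [v1 [t [pre [post [def_s _ [adj_t ne_t] un_t _]]]]]] : located s.
  elim: s adj_s un_s sz_s => // x [|y [|z s]] IHs // adj_s un_s _.
    have xy : adj x y by case/andP: adj_s.
    have [v [w [vw /infixP[p [q def_vw]]]]] := subdiv_edge sub xy.
    exists v, w, [::], p, q; split=> //=.
    - by rewrite -def_vw cats1.
    - by have := congr1 size def_vw; rewrite size_cat /= size_rcons; lia.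
    by rewrite vw.
  have /andP[xy adj_s'] := adj_s; have /andP[x_s un_s'] := un_s.
  by apply: located_cons => //; apply: IHs.
exists v0, (v1 :: t); split; last by rewrite def_s infix_infix.
rewrite /almost_path adj_t ne_t /= (_ : take _ _ = belast v1 t) //.
by rewrite lastI -cats1 take_size_cat // size_belast.
Qed.

End Subdivision.

(** * Colouring a subdivision *)

Lemma binary_codes B : exists code decode, forall n, n < 2 ^ B ->
  size (code n : seq bool) = B /\ decode (code n) = n :> nat.
Proof.
pose L := map val (enum {: B.-tuple bool}).
have sz_L : size L = 2 ^ B by rewrite size_map -cardE card_tuple card_bool.
have un_L : uniq L by rewrite map_inj_uniq ?enum_uniq //; apply: val_inj.
exists (nth [::] L), (fun w => index w L) => n lt_n; split; last by rewrite index_uniq ?sz_L.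
have : nth [::] L n \in L by rewrite mem_nth ?sz_L.
by case/mapP => t _ ->; rewrite size_tuple.
Qed.

Lemma nonrep_size_le1 (T : eqType) (s : seq T) : size s <= 1 -> nonrepetitive s.
Proof.
move=> le_s; apply/nonrepP => x x_nnil; apply/negP => /size_infix; rewrite size_cat.
by case: x x_nnil => //= a x _; lia.
Qed.

(** Two edges at [v] form a path, so they have different colours. *)
Lemma degree_le_chromatic_index (G : sgraph) (v : G) :
  #|adj v| <= nonrep_chromatic_index G.
Proof.
rewrite /nonrep_chromatic_index; case: ex_minnP => k /asboolP[f [f_lt f_nr]] _.
have ne_v w : adj v w -> w != v by apply: contraTneq => ->; rewrite adj_irrefl.
pose g w := f [set v; w].
have un_g : uniq (map g (enum (adj v))).
  rewrite map_inj_in_uniq ?enum_uniq // => w w'; rewrite !mem_enum.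
  rewrite -[w \in _]/(adj v w) -[w' \in _]/(adj v w') => vw vw' eq_f.
  have [//|ne_w] := eqVneq w w'.
  have gp : gpath [:: w; v; w'].
    by rewrite /gpath /= !inE negb_or ne_w adj_sym vw vw' ne_v // eq_sym ne_v.
  have := nonrep_cons_neq (f_nr _ gp).
  by rewrite /= setUC -/(g w) -/(g w') eq_f eqxx.
have : {subset map g (enum (adj v)) <= iota 0 k}.
  move=> c /mapP[w]; rewrite mem_enum -[w \in _]/(adj v w) => vw ->.
  rewrite mem_iota add0n /=; apply: f_lt.
  by apply/imsetP; exists (v, w); rewrite ?inE.
by move=> /(uniq_leq_size un_g); rewrite size_map -cardE size_iota.
Qed.

(** Over two letters, a word of length four without equal neighbours is itself a square. *)
Lemma three_colors_needed (G H : sgraph) (b : G -> H) (P : G -> G -> seq H) v w k :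
  is_subdivision b P -> adj v w -> 2 < size (P v w) ->
  nonrep_vertex_colorable H k -> 3 <= k.
Proof.
move=> sub vw sz_P /asboolP[f [f_lt f_nr]]; rewrite ltnNge; apply/negP => k_lt.
have f_lt2 x : f x < 2 by apply: leq_trans (f_lt x) k_lt.
move: sz_P; have := f_nr _ (subdiv_path sub vw).
case: (P v w) => [|x [|y [|z s]]] //.
move=> /nonrepP nr _.
have sq2 (c d : nat) l r : map f [:: b v, x, y, z & rcons s (b w)] = l ++ [:: c; d] ++ r -> c != d.
  move=> def_l; apply/eqP => eq_cd; have /negP[] := nr [:: c] ltac:(by []).
  by rewrite -[X in infix _ X]/(map f [:: b v, x, y, z & rcons s (b w)]) def_l eq_cd infix_infix.
have n1 := sq2 (f (b v)) (f x) [::] _ erefl.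
have n2 := sq2 (f x) (f y) [:: f (b v)] _ erefl.
have n3 := sq2 (f y) (f z) [:: f (b v); f x] _ erefl.
have := f_lt2 (b v); have := f_lt2 x; have := f_lt2 y; have := f_lt2 z.
move=> hz hy hx hv; have /negP[] := nr [:: f (b v); f x] ltac:(by []).
rewrite [map _ _]/=; have -> : f y = f (b v) by lia.
have -> : f z = f x by lia.
by rewrite /= !eqxx prefix0s.
Qed.

Section Coloring.
Variables (G H : sgraph) (b : G -> H) (P : G -> G -> seq H).
Hypothesis sub : is_subdivision b P.
Variables (B : nat) (col : {set G} -> seq bool).
Hypothesis B_gt0 : 0 < B.
Hypothesis col_size : forall e, size (col e) = B.
Hypothesis col_nonrep : forall s : seq G, almost_path s -> nonrepetitive (map col (path_edges s)).
Hypothesis P_size : forall v w, adj v w -> 33 + 33 * maxn 33 (2 * B) <= size (P v w).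

Let P_nnil v w : adj v w -> P v w <> [::].
Proof. by move=> /P_size; case: (P v w). Qed.

Let fits v w (E : seq (letter * seq nat)) := [/\ {subset E <= block_table},
  carries (col [set v; w]) (unzip1 E) & size (interior E) = size (P v w)].

Let fits_rev v w E : adj v w -> fits w v E -> fits v w (revblocks E).
Proof.
move=> vw [E_tab E_car E_sz]; split.
- by move=> p /mapP[q]; rewrite mem_rev => /E_tab q_tab ->; apply: revblock_table.
- by rewrite unzip1_revblocks setUC; apply: carries_rev.
- by rewrite -rev_interior size_rev E_sz (subdiv_rev sub vw) size_rev.
Qed.

Let exists_blocks : exists E : G -> G -> seq (letter * seq nat),
  forall v w, adj v w -> fits v w (E v w) /\ E w v = revblocks (E v w).
Proof.
have ex_E (p : G * G) : exists E, adj p.1 p.2 -> fits p.1 p.2 E.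
  case: p => v w /=; have [vw|nvw] := boolP (adj v w); last by exists [::].
  have [|E [E1 E2 E3]] := @ex_edge_blocks (col [set v; w]) (size (P v w)).
    by rewrite col_size P_size.
  by exists E.
have [E0 E0P] := boolp.choice ex_E.
(* The ranks orient each edge; the opposite direction gets the reversed blocks. *)
exists (fun v w => if enum_rank v < enum_rank w then E0 (v, w) else revblocks (E0 (w, v))).
move=> v w vw; have wv : adj w v by rewrite adj_sym.
have fvw := E0P (v, w) vw; have fwv := E0P (w, v) wv.
case: ltngtP => [lt_vw|lt_wv|/ord_inj/enum_rank_inj eq_vw].
- by split.
- by split; [exact: fits_rev | rewrite revblocksK].
by rewrite eq_vw adj_irrefl in vw.
Qed.

Theorem subdivision_3_colorable : nonrep_vertex_colorable H 3.
Proof.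
have [E EP] := exists_blocks.
(* Either orientation may be picked: the reversal property of [E] makes the colour the same. The
   final 0 is a default, as every vertex of [H] falls under one of the first two cases. *)
pose f x := if [exists u, x == b u] then branch_color else
  if [pick p : G * G | adj p.1 p.2 && (x \in P p.1 p.2)] is Some p
  then nth 0 (interior (E p.1 p.2)) (index x (P p.1 p.2)) else 0.
have f_b u : f (b u) = branch_color.
  by rewrite /f ifT //; apply/existsP; exists u.
have f_P v w : adj v w -> map f (P v w) = interior (E v w).
  move=> vw; have [[_ _ sz_E] E_rev] := EP v w vw.
  have un_P : uniq (P v w).
    by have /andP[_] := subdiv_path sub vw; rewrite cons_uniq rcons_uniq => /and3P[].
  apply: (@eq_from_nth _ 0) => [|i]; rewrite size_map // => lt_i.
  have x0 : H := b v.
  rewrite (nth_map x0) //; set x := nth x0 (P v w) i.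
  have x_vw : x \in P v w by apply: mem_nth.
  rewrite /f ifF; last first.
    by apply/existsP => -[u /eqP x_b]; have := subdiv_branch sub u vw; rewrite -x_b x_vw.
  case: pickP => [[v' w'] /= /andP[vw' x_vw']|/(_ (v, w))]; last by rewrite /= vw x_vw.
  have [eq_e|ne_e] := eqVneq [set v; w] [set v'; w']; last first.
    by have /disjointFr/(_ x_vw) := subdiv_disjoint sub vw vw' ne_e; rewrite x_vw'.
  case: (set2_eq eq_e) => -[ev ew]; subst v' w'; first by rewrite index_uniq.
  rewrite E_rev -rev_interior (subdiv_rev sub vw) nth_rev ?sz_E; last first.
    by rewrite -(size_rev (P v w)) index_mem mem_rev.
  have lt_rev : size (P v w) - i.+1 < size (P v w) by rewrite ltn_subrL (leq_ltn_trans _ lt_i).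
  congr nth; have -> : x = nth x0 (rev (P v w)) (size (P v w) - i.+1).
    by rewrite nth_rev ?lt_rev // subnSK // subKn // ltnW.
  by rewrite index_uniq ?rev_uniq ?size_rev // subnSK // subKn // ltnW.
have f_expand u t : sorted (@adj G) (u :: t) -> map f (expand b P u t) =
    sepword [:: branch_color] [seq (p.1, interior p.2) |
      p <- [seq (col [set e.1; e.2], E e.1 e.2) | e <- zip (u :: t) t]].
  elim: t u => [|w t IHt] u; first by rewrite /= f_b.
  case/andP=> uw adj_t; rewrite /= map_cat f_b f_P // IHt //.
  by rewrite sepword_cons.
apply/asboolP; exists f; split=> [x|s gs].
  rewrite /f; case: ifP => // _; case: pickP => // -[v w] /= /andP[vw x_vw].
  have [[E_tab _ sz_E] _] := EP v w vw.
  have : all (fun c => c < 3) (interior (E v w)).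
    by rewrite /interior 2!all_cat sepword_letters.
  by move=> /(all_nthP 0); apply; rewrite sz_E index_mem.
have [le_s|lt_s] := leqP (size s) 1; first by apply: nonrep_size_le1; rewrite size_map.
have [u [t [ut_ap s_ut]]] := path_in_expand sub P_nnil gs lt_s.
have adj_ut : sorted (@adj G) (u :: t) by case/and3P: ut_ap.
have /infixP[l [r def_ut]] := s_ut.
apply: (@nonrep_infix _ _ (map f (expand b P u t))).
  by rewrite def_ut !map_cat infix_infix.
rewrite f_expand //; apply: (interior_sepword_nonrep B_gt0).
  move=> _ /mapP[[v w] vw_ut ->] /=.
  have vw : adj v w.
    elim: t u adj_ut vw_ut {ut_ap s_ut def_ut} => // w' t IHt u /andP[uw' adj_t].
    by rewrite /= inE => /orP[/eqP[-> ->]|/IHt->].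
  by have [[]] := EP v w vw; rewrite col_size.
have -> : unzip1 [seq (col [set e.1; e.2], E e.1 e.2) | e <- zip (u :: t) t] =
  map col (path_edges (u :: t)) by rewrite /unzip1 -!map_comp.
exact: col_nonrep.
Qed.

End Coloring.

(** * Logarithmic estimates and the conclusion *)

Local Open Scope ring_scope.

Lemma ln2_ge_half (R : realType) : 2^-1 <= ln (2 : R).
Proof.
have : ln (1 + - 2^-1 : R) <= - 2^-1 by apply: le_ln1Dx; lra.
rewrite (_ : 1 + - 2^-1 = 2^-1 :> R); last by field.
by rewrite lnV ?posrE // lerN2.
Qed.

Lemma up_log_le_ln (R : realType) (n : nat) : (1 < n)%N ->
  (up_log 2 n)%:R <= 2 * ln (n%:R : R) + 1.
Proof.
move=> n_gt1; have lt_n := up_log_gtn (ltnSn 1) n_gt1.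
have log_gt0 : (0 < up_log 2 n)%N by rewrite up_log_gt0.
have : ln ((2 ^ (up_log 2 n).-1)%:R : R) <= ln n%:R.
  by rewrite ler_ln ?posrE ?ltr0n ?expn_gt0 ?ler_nat // ltnW // (ltn_trans _ n_gt1).
rewrite natrX lnXn // -[ln _ *+ _]mulr_natl => le_ln.
have le_p := ler_wpM2l (ler0n R (up_log 2 n).-1) (ln2_ge_half R).
have -> : (up_log 2 n)%:R = (up_log 2 n).-1%:R + 1 :> R by rewrite natr1 prednK.
lra.
Qed.

(** Let [n = 2 * D + 3] and [L = up_log 2 n]. As [ln 1.01 <= 1 / 100], the logarithmic term is at
    least [800 * ln n], so [L <= 2 * ln n + 1] gives [400 * L <= l + 400]; with [l >= 34 * 33] this
    is enough. *)
Lemma subdivision_length (R : realType) (D l : nat) :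
  Num.max 35216%:R (8 * (ln (2 * D%:R + 3) / ln (101 / 100)) + 216) <= l%:R :> R ->
  (33 + 33 * maxn 33 (2 * (2 + 2 * up_log 2 (2 * D + 3))) <= l)%N.
Proof.
rewrite ge_max => /andP[le1 le2].
have {}le1 : (34 * 33 <= l)%N by rewrite -(ler_nat R); apply: le_trans le1; rewrite ler_nat.
pose n := (2 * D + 3)%N; pose L := up_log 2 n.
have n_gt1 : (1 < n)%N by rewrite /n; lia.
have le_L : L%:R <= 2 * ln (n%:R : R) + 1 := up_log_le_ln R n_gt1.
have ln_n : 0 <= ln (n%:R : R) by rewrite ln_ge0 // ler1n ltnW.
have ln101 : ln (101 / 100 : R) <= 100^-1.
  by rewrite (_ : 101 / 100 = 1 + 100^-1 :> R); [apply: le_ln1Dx; lra | field].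
have ln101_gt0 : 0 < ln (101 / 100 : R) by rewrite ln_gt0 //; lra.
have le_l : 100 * ln (n%:R : R) <= ln (2 * D%:R + 3) / ln (101 / 100).
  rewrite ler_pdivlMr // (_ : 2 * D%:R + 3 = n%:R :> R); last by rewrite /n natrD natrM.
  by have le_p := ler_wpM2l ln_n ln101; lra.
have : (400 * L <= l + 400)%N.
  by rewrite -(ler_nat R) natrM natrD; lra.
by rewrite -/n -/L; lia.
Qed.

Theorem theorem5 (R : realType) (G : sgraph) (c : R) :
  (exists v w : G, adj v w) ->
  c = Num.max 35216%:R
        (8 * (ln (2 * (nonrep_chromatic_index G)%:R + 3) / ln (101 / 100)) + 216) ->
  forall H : sgraph, subdivision_ge c G H -> nonrep_chromatic_number H = 3%N.
Proof.
move=> G_edge -> H [b [P [sub le_P]]].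
set D := nonrep_chromatic_index G in le_P.
have D_gt0 : (0 < D)%N.
  have [v [w vw]] := G_edge; apply: leq_trans (degree_le_chromatic_index v).
  by apply/card_gt0P; exists w.
have [col0 [col0_lt col0_nr]] := exists_walk_coloring D_gt0 (@degree_le_chromatic_index G).
pose n := (2 * D + 3)%N; pose B := (2 + 2 * up_log 2 n)%N.
(* Since [12 * D ^ 2 <= 4 * n ^ 2 <= 2 ^ B], codes of [B] bits suffice for the walk colouring. *)
have B_ge : (12 * D ^ 2 <= 2 ^ B)%N.
  have le_n : (n <= 2 ^ up_log 2 n)%N by apply: up_logP.
  rewrite /B expnD (mulnC 2 (up_log 2 n)) expnM -!mulnn; move: (2 ^ _)%N le_n => X le_n.
  by apply: (@leq_trans (2 * 2 * (n * n))); [rewrite /n; nia | rewrite leq_mul // leq_mul].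
have [code [decode codeK]] := binary_codes B.
have col_code e : (col0 e < 2 ^ B)%N by apply: leq_trans B_ge.
pose col e := code (col0 e).
have col_size e : size (col e) = B by have [] := codeK _ (col_code e).
have col_nr (s : seq G) : almost_path s -> nonrepetitive (map col (path_edges s)).
  move=> s_ap; apply: (@nonrep_map_inv _ _ decode); rewrite -map_comp.
  rewrite (eq_map (g := col0)); first exact: col0_nr.
  by move=> e; have [] := codeK _ (col_code e).
have P_size (v w : G) : adj v w -> (33 + 33 * maxn 33 (2 * B) <= size (P v w))%N.
  by move=> /le_P; apply: subdivision_length.
have H3 : nonrep_vertex_colorable H 3.
  exact: (subdivision_3_colorable sub _ col_size col_nr P_size).
rewrite /nonrep_chromatic_number; case: ex_minnP => k k_col /(_ _ H3) le_k.
have [v [w vw]] := G_edge; apply/eqP; rewrite eqn_leq le_k.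
by apply: (three_colors_needed sub vw _ k_col); apply: leq_trans (P_size v w vw).
Qed.
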